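(* Let $F$ be a field and let $V$ be a four-dimensional vector space over $F$. A parallelism $\parallel$ of $\mathbb{P}(V)$ is Clifford if, and only if, it satisfies the following condition of crossed pencils: For all lines $M_1\parallel N_1$ and $M_2\parallel N_2$ such that $p:=M_1\cap M_2$ and $q:=N_1\cap N_2$ are two distinct points, the following holds: if the lines $M_1$, $M_2$, and $p\oplus q$ are in a common pencil of lines, then so are the lines $N_1$, $N_2$, and $p\oplus q$.
   Context: Fields are commutative and of arbitrary characteristic. For a vector space $U$ over $F$, $\mathbb{P}(U)$ is the projective space of all subspaces of $U$; points, lines, planes are the subspaces of vector dimension $1,2,3$. A pencil of lines is the set of all lines through a point $p$ lying in a plane $Z$, where $p\subset Z$. A parallelism of $\mathbb{P}(V)$ is an equivalence relation on the set of lines of $\mathbb{P}(V)$ such that each point is incident with precisely one line from each equivalence class. Conditions on an $F$-algebra $H$ (with $F$ identified with $F\cdot 1_H$): (A) $H$ is a quaternion skew field with centre $F$ (so $[H:F]=4$); (B) $H$ is an extension field of $F$ with $[H:F]=4$ and $h^2\in F$ for all $h\in H$. For such $H$, lines $M,N$ of $\mathbb{P}(H)$ are left parallel if $cM=N$ for some $c\in H\setminus\{0\}$, and right parallel if $Mc=N$ for some $c\in H\setminus\{0\}$; these two parallelisms are the canonical Clifford parallelisms of $\mathbb{P}(H)$. A parallelism $\parallel$ of $\mathbb{P}(V)$ is Clifford if the $F$-vector space $V$ can be made into an $F$-algebra $H:=V$ satisfying (A) or (B) such that $\parallel$ coincides with one of the canonical Clifford parallelisms of $\mathbb{P}(H)$.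 *)

(* Defs.v *)
From mathcomp Require Import all_boot all_algebra falgebra.
From Corelib Require Import RelationClasses.

Set Implicit Arguments.
Unset Strict Implicit.
Unset Printing Implicit Defensive.

Import GRing.Theory.
Local Open Scope ring_scope.

Section ProjectiveSpace.
Variables (F : fieldType) (V : vectType F).

(* Projective notions are expressed through the vector dimension [\dim], which
   exceeds the projective dimension by one. *)
Definition is_point (p : {vspace V}) : bool := \dim p == 1%N.
Definition is_line (L : {vspace V}) : bool := \dim L == 2.
Definition is_plane (Z : {vspace V}) : bool := \dim Z == 3.

Definition line : predArgType := {L : {vspace V} | is_line L}.
Definition vspace_of_line (M : line) : {vspace V} := val M.

End ProjectiveSpace.

Arguments line {F} V.
Coercion vspace_of_line : line >-> space.

Section Parallelisms.
Variables (F : fieldType) (V : vectType F).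
Implicit Types (p Z : {vspace V}) (par : line V -> line V -> Prop).

(* The equivalence classes are given by representatives: the class of [M] has
   exactly one member through the point [p]. *)
Definition parallelism par : Prop :=
  Equivalence par /\
  forall p (M : line V), is_point p ->
    exists! N : line V, par M N /\ (p <= N)%VS.

Definition pencil p Z : pred {vspace V} :=
  [pred L : {vspace V} | [&& is_line L, (p <= L)%VS & (L <= Z)%VS]].

Definition in_common_pencil (L1 L2 L3 : {vspace V}) : Prop :=
  exists p Z : {vspace V},
    [/\ is_point p, is_plane Z & (p <= Z)%VS] /\
    [/\ L1 \in pencil p Z, L2 \in pencil p Z & L3 \in pencil p Z].

Definition crossed_pencils par : Prop :=
  forall M1 N1 M2 N2 : line V,
    par M1 N1 -> par M2 N2 ->
    let p := (M1 :&: M2)%VS in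
    let q := (N1 :&: N2)%VS in
    is_point p -> is_point q -> p != q ->
    in_common_pencil M1 M2 (p + q)%VS -> in_common_pencil N1 N2 (p + q)%VS.

End Parallelisms.

Section CliffordAlgebras.
Variables (F : fieldType) (H : falgType F).

(* [1%VS : {vspace H}] is the copy F 1 of F inside H. *)

Definition division_algebra : Prop :=
  forall x : H, x != 0 -> x \is a GRing.unit.

Definition quaternion_skew_field : Prop :=
  [/\ \dim {:H} = 4, division_algebra & ('Z({:H}) = 1)%VS].

Definition quartic_field_with_squares_in_base : Prop :=
  [/\ \dim {:H} = 4, division_algebra, commutative (@GRing.mul H)
    & forall h : H, h ^+ 2 \in 1%VS].

Definition left_parallel (M N : {vspace H}) : Prop :=
  exists2 c : H, c != 0 & (amull c @: M)%VS = N.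

Definition right_parallel (M N : {vspace H}) : Prop :=
  exists2 c : H, c != 0 & (amulr c @: M)%VS = N.

End CliffordAlgebras.

(* An algebra structure on the vector space V is given, by transport, as an
   algebra H together with an F-linear bijection [phi] from V onto H. *)
Definition Clifford (F : fieldType) (V : vectType F)
    (par : line V -> line V -> Prop) : Prop :=
  exists (H : falgType F) (phi : 'Hom(V, H)),
    [/\ bijective phi,
        quaternion_skew_field H \/ quartic_field_with_squares_in_base H
      & (forall M N : line V,
           par M N <-> left_parallel (phi @: M)%VS (phi @: N)%VS) \/
        (forall M N : line V,
           par M N <-> right_parallel (phi @: M)%VS (phi @: N)%VS)].

(* Main.v *)
From HB Require Import structures.
Require Import Defs.
From mathcomp Require Import all_boot all_algebra falgebra.
From mathcomp Require Import ring.
From Corelib Require Import RelationClasses.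
From Stdlib Require Import IndefiniteDescription.

Set Implicit Arguments.
Unset Strict Implicit.
Unset Printing Implicit Defensive.

Import GRing.Theory VectorInternalTheory.
Local Open Scope ring_scope.

(** Suppose first that the parallelism comes from an algebra H. The line through
    q parallel to a given line through p is then its image under multiplication
    by a fixed element c that carries p to q. Every element of H is quadratic
    over F, so multiplication by the inverse of c is a combination of the
    identity and of multiplication by c. Hence a plane through p and q is
    carried by c to a plane that also contains both points
    ([crossed_pencils_of_action]).

    Conversely, let P L v be the line through the vector v parallel to L.
    Crossed pencils makes the relation 'q lies in the plane P L p + P M p'
    symmetric in p and q. It follows that every plane contains a line of each
    class ([par_dual]) and then that the bijections between stars of lines
    given by the parallelism preserve coplanarity ([par_coplanar]). So the
    classes are the points of a projective plane of their own. A line of that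
    plane is encoded by a web, which assigns to each point p the plane spanned
    by the lines through p from the chosen classes. Symmetry of webs shows that
    each class is a regular spread ([transversal_web], [par_regular]), and a
    regular spread consists of the lines spanned by v and f v, for a suitable
    linear map f ([regular_spread_lfun]). The linear maps that carry each
    vector along a fixed class, called classwise below, ought to be the right
    multiplications of the algebra. For vectors e <> 0 and y, exactly one of
    them sends e to y.

    It has to be shown that the classwise maps are closed under sums and
    products. This is done by constructing the other Clifford parallelism. Call
    D and f D opposite-parallel when f is classwise. Webs show that the line
    opposite-parallel to D through v depends only on D and v ([img_unique])
    and that the relation is transitive ([opposite_opposite]); its classes are
    regular spreads because classwise maps are linear. Hence there are linear
    maps g along the classes of this second parallelism, which ought to be the
    left multiplications. A classwise map f commutes with g at u whenever g u is
    not in the span of u and f u ([commute_at]). As g is linear,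
    the maps f inherit additivity ([JD]) and associativity ([J_assoc]).
    With J e y the classwise map sending e to y, the product of x and y is
    J e y x, and the given parallelism is its left parallelism. Each element is
    quadratic over F, because a classwise map preserves the lines of its class.
    A four-dimensional division algebra in which all elements are quadratic is
    a quaternion skew field with centre F or a field whose squares lie in F
    ([quadratic_division_algebra]). *)

(** * Lines and planes of a vector space *)

Section Coordinates.
Variables (F : fieldType) (V : vectType F).
Implicit Types (u v : V) (i : 'I_(dim V)).

Definition coordinate u i : F := v2r u 0 i.

Lemma coordinate_inj u v : coordinate u =1 coordinate v -> u = v.
Proof. by move=> eq_uv; apply/v2r_inj/rowP. Qed.
Lemma coordinateD u v i : coordinate (u + v) i = coordinate u i + coordinate v i.
Proof. by rewrite /coordinate linearD mxE. Qed.
Lemma coordinateN u i : coordinate (- u) i = - coordinate u i.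
Proof. by rewrite /coordinate linearN mxE. Qed.
Lemma coordinateZ a u i : coordinate (a *: u) i = a * coordinate u i.
Proof. by rewrite /coordinate linearZ mxE. Qed.
Lemma coordinate0 i : coordinate 0 i = 0.
Proof. by rewrite /coordinate linear0 mxE. Qed.

Definition coordinateE := (coordinateD, coordinateN, coordinateZ, coordinate0).

End Coordinates.

(** Linear identities between vectors are checked on coordinates, where they
    become identities between scalars. *)
Ltac lmod :=
  apply: coordinate_inj => ?; rewrite ?coordinateE; first [ring | field].

Section VectorSpaces.
Variables (F : fieldType) (V : vectType F).
Implicit Types (u v w : V) (U W E L M N : {vspace V}).

Lemma memv_scale U v (a : F) : a != 0 -> (a *: v \in U) = (v \in U).
Proof. by move=> nza; rewrite rpredZeq (negPf nza). Qed.

Lemma mem_addlineP U u v :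
  reflect (exists2 w, w \in U & exists a, v = w + a *: u) (v \in (U + <[u]>)%VS).
Proof.
apply: (iffP memv_addP) => [[w Uw [_ /vlineP[a ->] ->]]|[w Uw [a ->]]].
  by exists w => //; exists a.
by exists w => //; exists (a *: u); rewrite ?memvZ ?memv_line.
Qed.

Lemma mem_pairP u w v :
  reflect (exists a b, v = a *: u + b *: w) (v \in (<[u]> + <[w]>)%VS).
Proof.
apply: (iffP (mem_addlineP _ _ _)) => [[_ /vlineP[a ->] [b ->]]|[a [b ->]]].
  by exists a, b.
by exists (a *: u); rewrite ?memvZ ?memv_line //; exists b.
Qed.

Lemma dim_addline U v : v \notin U -> \dim (U + <[v]>) = (\dim U).+1.
Proof.
move=> Uv; rewrite dimv_disjoint_sum ?dim_vline.
  by rewrite (memPnC Uv) ?mem0v // addn1.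
apply/eqP; rewrite -subv0; apply/subvP => w /memv_capP[Uw /vlineP[a def_w]].
rewrite memv0; apply: contraR Uv => nzw; rewrite -(memv_scale _ _ (a := a)) -?def_w //.
by apply: contraNneq nzw => a0; rewrite def_w a0 scale0r.
Qed.

Lemma dim_pair u v : u != 0 -> v \notin <[u]>%VS -> \dim (<[u]> + <[v]>) = 2%N.
Proof. by move=> nzu uv; rewrite dim_addline // dim_vline nzu. Qed.

Lemma line_pairE L u v : \dim L = 2%N -> u \in L -> v \in L -> u != 0 ->
  v \notin <[u]>%VS -> L = (<[u]> + <[v]>)%VS.
Proof.
move=> dimL Lu Lv nzu uv; apply/eqP; rewrite eq_sym eqEdim dim_pair // dimL andbT.
by rewrite subv_add -!memvE Lu Lv.
Qed.

Lemma pair_indep u v (a b : F) : u != 0 -> v \notin <[u]>%VS ->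
  a *: u + b *: v = 0 -> a = 0 /\ b = 0.
Proof.
move=> nzu uv ab0; have b0 : b = 0.
  apply: contraNeq uv => nzb; rewrite -(memv_scale _ _ nzb).
  move/(canRL (addKr _)): ab0 => ->.
  by rewrite addr0 -scaleNr rpredZ ?memv_line.
split=> //; apply/eqP; move/eqP: ab0.
by rewrite b0 scale0r addr0 scaler_eq0 (negPf nzu) orbF.
Qed.

Lemma pair_exchange u v w : v \notin <[u]>%VS -> v \in (<[u]> + <[w]>)%VS ->
  w \in (<[u]> + <[v]>)%VS.
Proof.
move=> uv /mem_pairP[a [b vE]]; have nzb : b != 0.
  by apply: contraNneq uv => b0; rewrite vE b0 scale0r addr0 memvZ ?memv_line.
by apply/mem_pairP; exists (- (a / b)), b^-1; rewrite vE; lmod.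
Qed.

Lemma meet_nz U W E : (U <= E)%VS -> (W <= E)%VS -> (\dim E < \dim U + \dim W)%N ->
  exists v, [/\ v != 0, v \in U & v \in W].
Proof.
move=> sUE sWE; rewrite -dimv_sum_cap => dimE.
have dim_gt0: \dim (U :&: W) != 0%N.
  rewrite -lt0n -(ltn_add2l (\dim (U + W))) addn0 (leq_ltn_trans _ dimE) //.
  by rewrite dimvS // subv_add sUE.
exists (vpick (U :&: W)); rewrite vpick0 -dimv_eq0 dim_gt0.
by have /memv_capP[] := memv_pick (U :&: W).
Qed.

Lemma ex_notin U E : (\dim U < \dim E)%N -> exists2 v, v \in E & v \notin U.
Proof. by move=> ltUE; apply/subvPn; apply: contraL ltUE => /dimvS; rewrite -leqNgt. Qed.

(** The complement of a proper subspace spans the whole space, over every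
    field. *)
Lemma eq_lfun_off (f g : 'End(V)) U : (\dim U < \dim {:V})%N ->
  (forall v, v \notin U -> f v = g v) -> f = g.
Proof.
move=> ltUV eqfg; apply/lfunP => v; have [w _ Uw] := ex_notin ltUV.
case: (boolP (v \in U)) => [Uv|/eqfg//].
have: f (v + w) = g (v + w) by rewrite eqfg // rpredDl.
by rewrite !linearD /= (eqfg w Uw) => /addIr.
Qed.

Lemma mem_pairl u v : u \in (<[u]> + <[v]>)%VS.
Proof. by rewrite memvE addvSl. Qed.
Lemma mem_pairr u v : v \in (<[u]> + <[v]>)%VS.
Proof. by rewrite memvE addvSr. Qed.

Lemma nz_notin v L : v \notin L -> v != 0.
Proof. by apply: contraNneq => ->; rewrite mem0v. Qed.

Lemma dim_lines_le M N v : \dim M = 2%N -> \dim N = 2%N -> v != 0 -> v \in M ->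
  v \in N -> (\dim (M + N) <= 3)%N.
Proof.
move=> dM dN nzv Mv Nv; rewrite -(leq_add2r (\dim (M :&: N))) dimv_sum_cap dM dN.
have : (<[v]> <= M :&: N)%VS by rewrite -memvE memv_cap Mv.
by move/dimvS; rewrite dim_vline nzv; case: (\dim _).
Qed.

Lemma dim_lines M N v : \dim M = 2%N -> \dim N = 2%N -> v != 0 -> v \in M ->
  v \in N -> M != N -> \dim (M + N) = 3%N.
Proof.
move=> dM dN nzv Mv Nv neqMN; apply/eqP; rewrite eqn_leq (dim_lines_le dM dN nzv) //=.
rewrite ltnNge; apply: contra neqMN => le2.
have /eqP MN : M == (M + N)%VS by rewrite eqEdim addvSl dM.
by rewrite eq_sym eqEdim dM dN andbT MN addvSr.
Qed.

Lemma dim_eq_sub M N : (M <= N)%VS -> (\dim N <= \dim M)%N -> M = N.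
Proof. by move=> sMN leNM; apply/eqP; rewrite eqEdim sMN. Qed.

End VectorSpaces.

(** * Linear maps along a regular spread *)

Section Spreads.
Variables (F : fieldType) (V : vectType F).
Hypothesis dimV : \dim {:V} = 4%N.
Implicit Types (u v w e x y z : V) (S : V -> {vspace V}).

(** The spread is given by the function sending a nonzero vector to the member
    containing it. *)
Definition spread S : Prop :=
  [/\ forall v, v != 0 -> \dim (S v) = 2%N,
      forall v, v != 0 -> v \in S v
    & forall v w, v != 0 -> w != 0 -> w \in S v -> S w = S v].

(** The members meeting the line <[e, x]> are the lines of a regulus: each of its
    transversals <[y, z]> is parametrised by the same scalars as <[e, x]>. *)
Definition regular S : Prop := forall e x y,
  e != 0 -> x \notin S e -> y \in S e ->
  exists2 z, z \in S x & forall a b : F, a *: y + b *: z \in S (a *: e + b *: x).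

Variables (S : V -> {vspace V}) (spreadS : spread S).

Lemma spread_dim v : v != 0 -> \dim (S v) = 2%N.
Proof. by case: spreadS => + _ _; apply. Qed.
Lemma spread_mem v : v != 0 -> v \in S v.
Proof. by case: spreadS => _ + _; apply. Qed.
Lemma spread_eq v w : v != 0 -> w != 0 -> w \in S v -> S w = S v.
Proof. by case: spreadS => _ _; apply. Qed.

Lemma spread_skew v w u :
  v != 0 -> w \notin S v -> u \in S v -> u \in S w -> u = 0.
Proof.
move=> nzv Svw Svu Swu; have nzw := nz_notin Svw.
apply: contraNeq Svw => nzu.
by rewrite -(spread_eq nzv nzu Svu) (spread_eq nzw nzu Swu) spread_mem.
Qed.

Lemma spread_notin_sym v w : v != 0 -> w \notin S v -> v \notin S w.
Proof.
move=> nzv Svw; apply: contraNN Svw => Swv.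
case: (eqVneq w 0) => [->|nzw]; first exact: mem0v.
by rewrite (spread_eq nzw nzv Swv) spread_mem.
Qed.

Lemma spread_notinD v w (a : F) :
  v != 0 -> w \notin S v -> v + a *: w \notin S w.
Proof.
move=> nzv Svw; apply: contra (spread_notin_sym nzv Svw) => Swvw.
by rewrite -[v](addrK (a *: w)) rpredB ?rpredZ ?spread_mem ?(nz_notin Svw).
Qed.

(** Off the member of e, the value f x = f (e + x) lies in two skew members. *)
Lemma spread_lfun_eq0 (f : 'End(V)) e :
  (forall v, v != 0 -> f v \in S v) -> e != 0 -> f e = 0 -> f = 0.
Proof.
move=> fS nze fe0; apply: (@eq_lfun_off _ _ _ _ (S e)) => [|x Sex].
  by rewrite spread_dim // dimV.
rewrite zero_lfunE; have nzx := nz_notin Sex.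
have exS : e + x \notin S x.
  by have := spread_notinD 1 nze Sex; rewrite scale1r.
have nzex := nz_notin exS.
apply: (spread_skew nzx exS (fS x nzx)).
by have := fS _ nzex; rewrite linearD /= fe0 add0r.
Qed.

Lemma spread_lfun_inj (f g : 'End(V)) e :
  (forall v, v != 0 -> f v \in S v) -> (forall v, v != 0 -> g v \in S v) ->
  e != 0 -> f e = g e -> f = g.
Proof.
move=> fS gS nze fge; apply/eqP; rewrite -subr_eq0; apply/eqP.
apply: (@spread_lfun_eq0 _ e) => // [v nzv|].
  by rewrite !lfun_simp rpredB ?fS ?gS.
by rewrite !lfun_simp fge subrr.
Qed.

Hypothesis regularS : regular S.

(** The map e, g, n1 |-> y, n1, n2 goes along the spread on the whole plane
    spanned by e and by M = S g. Regularity, used on the lines through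
    e + a g and through e + b n1, gives this only up to an error term
    a b k with k in M. Since distinct members of the spread are disjoint, the
    resulting map (a, b) |-> a n1 + b n2 + a b k is injective, and this
    forces k = 0. A scaling argument would give the same for |F| > 2
    only. *)
Lemma plane_regular e g y n1 n2 :
  e != 0 -> g \notin S e -> y \in S e -> y \notin <[e]>%VS ->
  n1 \in S g -> n1 \notin <[g]>%VS -> n2 \in S g ->
  (forall a b : F, a *: y + b *: n1 \in S (a *: e + b *: g)) ->
  (forall a b : F, a *: y + b *: n2 \in S (a *: e + b *: n1)) ->
  forall a b : F, y + a *: n1 + b *: n2 \in S (e + a *: g + b *: n1).
Proof.
move=> nze Seg Sey ey Mn1 gn1 Mn2 yn1 yn2.
have nzg := nz_notin Seg.
have nzn1 : n1 != 0 by apply: contraNneq gn1 => ->; rewrite mem0v.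
have nzy : y != 0 by apply: contraNneq ey => ->; rewrite mem0v.
set M := S g in Mn1 Mn2.
have Mg : g \in M by exact: spread_mem.
have Me : e \notin M := spread_notin_sym nze Seg.
have My : y \notin M.
  by apply/negP => My; case/eqP: nzy; apply: (spread_skew nze Seg).
have offM u : u \in M -> [/\ e + u != 0, e + u \notin M & forall v, v \in M -> v \in S (e + u) -> v = 0].
  move=> Mu; have Meu : e + u \notin M by rewrite rpredDr.
  split=> //; last by move=> v Mv; apply: (spread_skew nzg).
  by apply: contraNneq Meu => ->; rewrite mem0v.
have uniqM u n n' : u \in M -> n \in M -> n' \in M ->
    y + n \in S (e + u) -> y + n' \in S (e + u) -> n = n'.
  move=> Mu Mn Mn' Sn Sn'; have [_ _ sk] := offM u Mu.
  apply/eqP; rewrite -subr_eq0; apply/eqP/sk; first by rewrite rpredB.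
  have -> : n - n' = (y + n) - (y + n') by lmod.
  by rewrite rpredB.
have SM u : u \in M -> u != 0 -> S u = M by move=> Mu nzu; exact: spread_eq.
have injM u u' n : u \in M -> u' \in M -> n \in M ->
    y + n \in S (e + u) -> y + n \in S (e + u') -> u = u'.
  move=> Mu Mu' Mn Sn Sn'; have [nzu ou sk] := offM u Mu; have [nzu' ou' _] := offM u' Mu'.
  have nzyn : y + n != 0.
    by apply: contraNneq My => /eqP; rewrite addr_eq0 => /eqP ->; rewrite rpredN.
  have eqS : S (e + u) = S (e + u').
    by rewrite -(spread_eq nzu nzyn Sn) (spread_eq nzu' nzyn Sn').
  apply/eqP; rewrite -subr_eq0; apply/eqP/sk; first by rewrite rpredB.
  have -> : u - u' = (e + u) - (e + u') by lmod.
  by rewrite rpredB ?spread_mem // eqS spread_mem.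
have Z a : exists2 z, z \in M &
    forall b, y + a *: n1 + b *: z \in S (e + (a *: g + b *: n1)).
  have [nzx _ sk] := offM (a *: g) (memvZ a Mg).
  have Sx : n1 \notin S (e + a *: g).
    by apply: contraNN nzn1 => /(sk _ Mn1) ->.
  have Sy : y + a *: n1 \in S (e + a *: g) by have := yn1 1 a; rewrite !scale1r.
  have [z Mz zP] := regularS nzx Sx Sy; exists z; first by rewrite -(SM n1).
  by move=> b; have := zP 1 b; rewrite !scale1r addrA.
have W b : exists2 w, w \in M &
    forall a, y + b *: n2 + a *: w \in S (e + (a *: g + b *: n1)).
  have [nzx _ sk] := offM (b *: n1) (memvZ b Mn1).
  have Sx : g \notin S (e + b *: n1).
    by apply: contraNN nzg => /(sk _ Mg) ->.
  have Sy : y + b *: n2 \in S (e + b *: n1) by have := yn2 1 b; rewrite !scale1r.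
  have [w Mw wP] := regularS nzx Sx Sy; exists w => // a.
  by have := wP 1 a; rewrite !scale1r -(addrA e) (addrC (b *: n1)).
have [w1 Mw1 w1P] := W 1; pose k := w1 - n1.
have Mk : k \in M by rewrite rpredB.
have J a b : y + (a *: n1 + b *: n2 + (a * b) *: k) \in S (e + (a *: g + b *: n1)).
  have [z Mz zP] := Z a.
  have -> : y + (a *: n1 + b *: n2 + (a * b) *: k) = y + a *: n1 + b *: z; last exact: zP.
  have := w1P a; have := zP 1; rewrite !scale1r -!addrA => S1 S2.
  have : a *: n1 + z = n2 + a *: w1.
    by apply: uniqM S1 S2; rewrite ?rpredD ?rpredZ.
  move/(canRL (addKr _)) => ->; rewrite /k; lmod.
(* it remains to remove the bilinear error term *)
suff k0 : k = 0 by move=> a b; have := J a b; rewrite k0 scaler0 addr0 !addrA.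
have injJ a b a' b' : a *: n1 + b *: n2 + (a * b) *: k =
    a' *: n1 + b' *: n2 + (a' * b') *: k -> a *: g + b *: n1 = a' *: g + b' *: n1.
  move=> eqJ; have := J a' b'; rewrite -eqJ => J'.
  by apply: injM (J a b) J'; rewrite ?rpredD ?rpredZ.
have {}injJ a b a' b' : a *: n1 + b *: n2 + (a * b) *: k =
    a' *: n1 + b' *: n2 + (a' * b') *: k -> a = a' /\ b = b'.
  move/injJ => eqg; have [] := @pair_indep _ _ g n1 (a - a') (b - b') nzg gn1.
    have -> : (a - a') *: g + (b - b') *: n1 =
      a *: g + b *: n1 - (a' *: g + b' *: n1) by lmod.
    by rewrite eqg subrr.
  by move=> /subr0_eq -> /subr0_eq ->.
have one0 : 1 <> 0 :> F by apply/eqP; exact: oner_neq0.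
apply/eqP; apply/negP => /negP nzk.
(* each pair of parameters below is chosen to contradict [injJ] *)
have kn2 : n2 \notin <[k]>%VS.
  apply/negP => /vlineP[c n2k]; case: (injJ (- c) 1 (- c) 0) => [|_].
    by rewrite n2k; lmod.
  exact: one0.
have /mem_pairP[p [q n1E]] : n1 \in (<[k]> + <[n2]>)%VS.
  by rewrite -(line_pairE (spread_dim nzg) Mk Mn2).
have [q0|nzq] := eqVneq q 0.
  case: (injJ 1 (- p) 0 (- p)) => [|/one0 //].
    by rewrite n1E q0; lmod.
have [p0|nzp] := eqVneq p 0.
  case: (injJ 1 0 0 q) => [|/one0 //].
    by rewrite n1E p0; lmod.
case: (injJ (p / q) (- p) 0 0) => [|_ /eqP].
  by rewrite n1E; lmod.
by rewrite oppr_eq0 (negPf nzp).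
Qed.

(** In the end f satisfies f ^ 2 = p + q f for scalars p and q. Regularity gives
    f g = n1 and f n1 = n2, and n2 = p g + q n1 defines p and q; the value of f at
    y = f e is then forced to be p e + q y. With this choice f preserves the
    plane spanned by u1 and f u1 for every u1, so it suffices to see that f goes
    along the spread on the plane spanned by S g and e, which meets all
    members. *)
Lemma regular_spread_lfun e y : e != 0 -> y \in S e ->
  exists2 J : 'End(V), J e = y & forall v, v != 0 -> J v \in S v.
Proof.
move=> nze Sey; have [/vlineP[c ->]|ey] := boolP (y \in <[e]>%VS).
  exists (c *: \1%VF) => [|v nzv]; first by rewrite !lfun_simp.
  by rewrite !lfun_simp memvZ ?spread_mem.
have [g _ Seg] : exists2 g, g \in {:V}%VS & g \notin S e.
  by apply: ex_notin; rewrite spread_dim ?dimV.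
have nzg := nz_notin Seg.
have [n1 Mn1 n1P] := regularS nze Seg Sey.
have sk u : u \in S g -> u \in S e -> u = 0.
  by move=> Mu Su; apply: (spread_skew nze Seg).
have gn1 : n1 \notin <[g]>%VS.
  apply: contra ey => /vlineP[c n1E].
  have Seg' : e + g \notin S e by rewrite rpredDl ?spread_mem.
  suff /subr0_eq -> : y - c *: e = 0 by rewrite memvZ ?memv_line.
  apply: (spread_skew nze Seg'); first by rewrite rpredB ?memvZ ?spread_mem.
  have -> : y - c *: e = 1 *: y + 1 *: n1 - c *: (e + g) by rewrite n1E; lmod.
  rewrite rpredB ?memvZ ?spread_mem ?(nz_notin Seg') //.
  by have := n1P 1 1; rewrite !scale1r.
have nzn1 : n1 != 0 by apply: contraNneq gn1 => ->; rewrite mem0v.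
have SM : S n1 = S g by apply: spread_eq.
have Sen1 : n1 \notin S e by apply: contraNN nzn1 => /(sk _ Mn1) ->.
have [n2 Mn2 n2P] := regularS nze Sen1 Sey; rewrite SM in Mn2.
have plane := plane_regular nze Seg Sey ey Mn1 gn1 Mn2 n1P n2P.
have Mg := spread_mem nzg; have Se := spread_mem nze.
have Mgn1 := line_pairE (spread_dim nzg) Mg Mn1 nzg gn1.
have Sey' := line_pairE (spread_dim nze) Se Sey nze ey.
have /mem_pairP[p [q n2E]] : n2 \in (<[g]> + <[n1]>)%VS by rewrite -Mgn1.
have VE : {:V}%VS = (S g + S e)%VS.
  apply/esym/eqP; rewrite eqEdim subvf dimv_disjoint_sum ?spread_dim ?dimV //.
  apply/eqP; rewrite -subv0; apply/subvP => u /memv_capP[Mu Su].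
  by rewrite memv0 (sk u).
have freeX : free [:: g; n1; e; y].
  rewrite /free span_def !big_cons big_nil addv0 /= addvA -Mgn1 -Sey' -VE.
  by rewrite dimV.
(* n1, n2 are the images of g, n1, and f acts on <[e, y]> as on <[g, n1]> *)
have [f fP] := linear_of_free [:: g; n1; e; y] [:: n1; n2; y; p *: e + q *: y].
have [fg fn1 fe fy] := fP freeX erefl.
exists (linfun f) => [|v nzv]; first by rewrite lfunE.
rewrite lfunE; have [Mv|Mv] := boolP (v \in S g).
  rewrite (spread_eq nzg nzv Mv); move: Mv; rewrite {1}Mgn1 => /mem_pairP[a [b ->]].
  by rewrite linearD !linearZ /= fg fn1 rpredD ?memvZ.
have [u [nzu Svu Eu]] : exists u, [/\ u != 0, u \in S v & u \in (S g + <[e]>)%VS].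
  apply: (meet_nz (subvf _) (subvf _)).
  by rewrite dimV spread_dim // dim_addline ?spread_dim // (spread_notin_sym nze).
have /mem_addlineP[m + [c uE]] := Eu; rewrite Mgn1 => /mem_pairP[a [b mE]].
have Mm : m \in S g by rewrite mE rpredD ?memvZ.
have nzc : c != 0.
  apply: contraNneq Mv => c0; have Mu : u \in S g by rewrite uE c0 scale0r addr0.
  by rewrite -(spread_eq nzg nzu Mu) (spread_eq nzv nzu Svu) spread_mem.
(* the member of v meets the plane spanned by S g and e in the point of u1 *)
pose u1 := e + (a / c) *: g + (b / c) *: n1.
have uE1 : u = c *: u1 by rewrite uE mE /u1; lmod.
have nzu1 : u1 != 0 by apply: contraNneq nzu => u10; rewrite uE1 u10 scaler0.
have -> : S v = S u1.
  by apply/esym/spread_eq; rewrite // -(memv_scale _ _ nzc) -uE1.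
pose u2 := y + (a / c) *: n1 + (b / c) *: n2.
have Su2 : u2 \in S u1 by exact: plane.
have fu1 : f u1 = u2 by rewrite /u1 /u2 !linearD !linearZ /= fe fg fn1.
have fn2 : f n2 = p *: n1 + q *: n2 by rewrite {1}n2E linearD !linearZ /= fg fn1.
have fu2 : f u2 = p *: u1 + q *: u2.
  by rewrite /u2 !linearD !linearZ /= fy fn1 fn2 /u1 n2E; lmod.
have u12 : u2 \notin <[u1]>%VS.
  apply/negP => /vlineP[d u2E].
  case/vlineP: (ey); exists d; apply/subr0_eq/sk; last by rewrite rpredB ?memvZ.
  have -> : y - d *: e = d *: ((a / c) *: g + (b / c) *: n1)
    - ((a / c) *: n1 + (b / c) *: n2).
    by apply/subr0_eq; rewrite -(subrr (d *: u1)) -{1}u2E; lmod.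
  by rewrite rpredB ?memvZ ?rpredD ?memvZ.
have : v \in S u1.
  by rewrite (spread_eq nzv nzu1) ?spread_mem // -(memv_scale _ _ nzc) -uE1.
rewrite (line_pairE (spread_dim nzu1) (spread_mem nzu1) Su2 nzu1 u12).
case/mem_pairP=> s [t ->]; rewrite linearD !linearZ /= fu1 fu2.
by apply/mem_pairP; exists (t * p), (s + t * q); lmod.
Qed.

End Spreads.

(** * The plane of parallel classes *)

Section ParallelFunctions.
Variables (F : fieldType) (V : vectType F).
Hypothesis dimV : \dim {:V} = 4%N.
Implicit Types (u v w p q e x y z : V) (L M N E D : {vspace V}) (W : V -> {vspace V}).

(** A parallelism in functional form: P L v is the line through v parallel to L. *)
Definition parallel_fun (P : {vspace V} -> V -> {vspace V}) : Prop :=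
  [/\ forall L v, \dim L = 2%N -> v != 0 -> \dim (P L v) = 2%N,
      forall L v, \dim L = 2%N -> v != 0 -> v \in P L v,
      forall L v, \dim L = 2%N -> v != 0 -> v \in L -> P L v = L
    & forall L w v, \dim L = 2%N -> w != 0 -> v != 0 -> P (P L w) v = P L v].

(** The condition of crossed pencils, stated at vectors spanning the points. It
    also holds when the four lines do not form two honest pencils (equal points
    or equal classes), which saves case distinctions later. *)
Definition crossed_fun (P : {vspace V} -> V -> {vspace V}) : Prop :=
  forall L M p q, \dim L = 2%N -> \dim M = 2%N -> p != 0 -> q != 0 ->
    q \in (P L p + P M p)%VS -> p \in (P L q + P M q)%VS.

Variables (P : {vspace V} -> V -> {vspace V}) (parP : parallel_fun P).

Lemma par_dim L v : \dim L = 2%N -> v != 0 -> \dim (P L v) = 2%N.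
Proof. by case: parP => + _ _ _; apply. Qed.
Lemma par_mem L v : \dim L = 2%N -> v != 0 -> v \in P L v.
Proof. by case: parP => _ + _ _; apply. Qed.
Lemma par_id L v : \dim L = 2%N -> v != 0 -> v \in L -> P L v = L.
Proof. by case: parP => _ _ + _; apply. Qed.
Lemma par_par L w v : \dim L = 2%N -> w != 0 -> v != 0 -> P (P L w) v = P L v.
Proof. by case: parP => _ _ _; apply. Qed.

Lemma par_spread L : \dim L = 2%N -> spread (P L).
Proof.
move=> dL; split=> [v|v|v w nzv nzw vw]; [exact: par_dim | exact: par_mem |].
by rewrite -(par_par dL nzv nzw) par_id ?par_dim.
Qed.

Lemma par_eq_at L M p q : \dim L = 2%N -> \dim M = 2%N -> p != 0 -> q != 0 ->
  P L p = P M p -> P L q = P M q.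
Proof. by move=> dL dM nzp nzq eqp; rewrite -(par_par dL nzp nzq) eqp par_par. Qed.

Hypothesis crossed : crossed_fun P.

(** Take a point p of E and a line A of E off p. The plane spanned by the lines
    P L p and P A p meets A in some q. By crossed pencils p lies in
    P L q + P A q = P L q + A, so this plane is E. *)
Lemma par_dual E L : \dim E = 3%N -> \dim L = 2%N ->
  exists2 q, q != 0 & (P L q <= E)%VS.
Proof.
move=> dE dL; pose p := vpick E; have Ep : p \in E := memv_pick E.
have nzp : p != 0 by rewrite vpick0 -dimv_eq0 dE.
pose A := (E :\: <[p]>)%VS; have AE : (A <= E)%VS := diffvSl _ _.
have dA : \dim A = 2%N.
  have := dimv_cap_compl E <[p]>; have /capv_idPr -> : (<[p]> <= E)%VS by [].
  by rewrite dim_vline nzp dE => -[].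
have Ap : p \notin A.
  apply: contra nzp => Ap; rewrite -memv0 -(capv_diff E <[p]>) memv_cap memv_line.
  by rewrite Ap.
have [eqLA|neqLA] := eqVneq (P L p) (P A p).
  have nzq : vpick A != 0 by rewrite vpick0 -dimv_eq0 dA.
  by exists (vpick A); rewrite // (par_eq_at dL dA nzp nzq eqLA) par_id ?memv_pick.
have [q [nzq Aq Gq]] : exists q, [/\ q != 0, q \in A & q \in (P L p + P A p)%VS].
  apply: (meet_nz (subvf _) (subvf _)).
  by rewrite dimV dA (dim_lines (v := p)) ?par_dim ?par_mem.
have := crossed dL dA nzp nzq Gq; rewrite (par_id dA nzq Aq) => Gp; exists q => //.
have EE : E = (A + <[p]>)%VS.
  by apply/esym/dim_eq_sub; rewrite ?subv_add ?AE // dE dim_addline ?dA.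
have -> : E = (P L q + A)%VS; last exact: addvSl.
apply: dim_eq_sub; first by rewrite EE subv_add addvSr.
by rewrite dE (dim_lines_le (v := q)) ?par_dim ?par_mem.
Qed.

(** If L and M differ at p, then D lies in the plane P L p + P M p, hence by
    crossed pencils also in the plane P L q + P M q. *)
Lemma par_transport L M p q (D := (<[p]> + <[q]>)%VS) :
  \dim L = 2%N -> \dim M = 2%N -> p != 0 -> q \notin <[p]>%VS -> P M p != D ->
  (P L p <= D + P M p)%VS -> (P L q <= D + P M q)%VS.
Proof.
move=> dL dM nzp pq neqD sLD; have nzq := nz_notin pq.
have dD : \dim D = 2%N := dim_pair nzp pq.
have [Dp Dq] : p \in D /\ q \in D by rewrite mem_pairl mem_pairr.
have [eqLM|neqLM] := eqVneq (P L p) (P M p).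
  by rewrite (par_eq_at dL dM nzp nzq eqLM) addvSr.
have neqDq : D != P M q.
  apply: contraNneq neqD => eqDM; apply/eqP.
  by rewrite -(par_par dM nzq nzp) -eqDM par_id.
have eqp : (P L p + P M p)%VS = (D + P M p)%VS.
  apply: dim_eq_sub; first by rewrite subv_add sLD addvSr.
  by rewrite (dim_lines (v := p) _ _ _ _ _ neqLM) ?(dim_lines_le (v := p)) ?par_dim ?par_mem.
have Eq : q \in (P L p + P M p)%VS by rewrite eqp memvE (subv_trans _ (addvSl _ _)) // -memvE.
have := crossed dL dM nzp nzq Eq => Ep.
have -> : (D + P M q)%VS = (P L q + P M q)%VS; last exact: addvSl.
apply: dim_eq_sub.
  rewrite !subv_add -!memvE Ep addvSr andbT memvE (subv_trans _ (addvSl _ _)) //.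
  by rewrite -memvE par_mem.
by rewrite (dim_lines (v := q) _ _ _ _ _ neqDq) ?(dim_lines_le (v := q)) ?par_dim ?par_mem.
Qed.

(** One of the lines P M p and P N p differs from <[p, q]>; the other two lines are
    compared with it by [par_transport]. *)
Lemma par_coplanar_in L M N p q :
  \dim L = 2%N -> \dim M = 2%N -> \dim N = 2%N -> p != 0 -> q != 0 ->
  P M p != P N p -> q \in (P M p + P N p)%VS ->
  (P L p <= P M p + P N p)%VS -> (P L q <= P M q + P N q)%VS.
Proof.
move=> dL dM dN nzp nzq neqMN Eq sL.
have [/vlineP[c qE]|pq] := boolP (q \in <[p]>%VS).
  have SE A : \dim A = 2%N -> P A q = P A p.
    by move=> dA; apply: (spread_eq (par_spread dA)); rewrite // qE memvZ ?par_mem.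
  by rewrite !SE.
pose D := (<[p]> + <[q]>)%VS; have dD : \dim D = 2%N := dim_pair nzp pq.
wlog neqMD : M N dM dN neqMN Eq sL / P M p != D.
  move=> wl; have [MD|] := eqVneq (P M p) D; last exact: wl.
  by rewrite addvC; apply: wl; rewrite // 1?eq_sym // 1?addvC // -MD.
have EE : (P M p + P N p)%VS = (D + P M p)%VS.
  apply/esym/dim_eq_sub.
    by rewrite !subv_add -!memvE Eq addvSl andbT memvE (subv_trans _ (addvSl _ _)) // -memvE par_mem.
  rewrite [(D + _)%VS]addvC (dim_lines (v := p) _ _ _ _ _ neqMD) ?par_dim ?par_mem ?mem_pairl //.
  by rewrite (dim_lines_le (v := p)) ?par_dim ?par_mem.
have Lq := par_transport dL dM nzp pq neqMD; rewrite -EE in Lq.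
have Nq : (P N q <= D + P M q)%VS by apply: par_transport; rewrite // -/D -EE addvSr.
suff -> : (P M q + P N q)%VS = (D + P M q)%VS by exact: Lq.
apply: dim_eq_sub; first by rewrite subv_add Nq addvSr.
rewrite (dim_lines (v := q) (M := P M q)) ?par_dim ?par_mem //.
  by rewrite (dim_lines_le (v := q)) ?par_dim ?par_mem ?mem_pairr.
by apply: contraNneq neqMN => /(par_eq_at dM dN nzq nzp) ->.
Qed.

(** If q is not in the plane spanned at p, the dual spread property gives a point
    r on P M p such that q lies in the plane spanned at r; the passage from p to q
    is then split at r. *)
Lemma par_coplanar L M N p q :
  \dim L = 2%N -> \dim M = 2%N -> \dim N = 2%N -> p != 0 -> q != 0 ->
  (P L p <= P M p + P N p)%VS -> (P L q <= P M q + P N q)%VS.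
Proof.
move=> dL dM dN nzp nzq sL.
have [eqMN|neqMN] := eqVneq (P M p) (P N p).
  rewrite -(par_eq_at dM dN nzp nzq eqMN) addvv.
  suff eqLM : P L p = P M p by rewrite (par_eq_at dL dM nzp nzq eqLM).
  by apply: dim_eq_sub; rewrite ?par_dim // (subv_trans sL) // eqMN addvv.
have [Eq|Eq] := boolP (q \in (P M p + P N p)%VS).
  exact: par_coplanar_in sL.
have Mq : q \notin P M p by apply: contra Eq; apply/subvP/addvSl.
have dE : \dim (P M p + <[q]>)%VS = 3%N by rewrite dim_addline ?par_dim.
have [s nzs sN] := par_dual dE dN.
have [r [nzr Mr Nr]] : exists r, [/\ r != 0, r \in P M p & r \in P N s].
  by apply: (meet_nz (addvSl _ _) sN); rewrite dE !par_dim.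
have NrE : P N r = P N s by apply: (spread_eq (par_spread dN)).
have MrE : P M r = P M p by apply: (spread_eq (par_spread dM)).
have neqr : P M r != P N r.
  by apply: contraNneq neqMN => /(par_eq_at dM dN nzr nzp) ->.
have sLr : (P L r <= P M r + P N r)%VS.
  apply: par_coplanar_in sL; rewrite // memvE (subv_trans _ (addvSl _ _)) //.
apply: (par_coplanar_in _ _ _ nzr) sLr; rewrite //.
suff -> : (P M r + P N r)%VS = (P M p + <[q]>)%VS by rewrite memvE addvSr.
apply: dim_eq_sub; first by rewrite subv_add MrE NrE sN addvSl.
by rewrite dE (dim_lines (v := r)) ?par_dim ?par_mem.
Qed.

(** Three parallel classes being coplanar at one point, hence at all points, means
    that they are collinear in the plane of classes. A web is a line of that
    plane: W v is spanned by the lines through v of the classes on it. *)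
Definition web W : Prop := forall v, v != 0 ->
  [/\ \dim (W v) = 3%N, v \in W v,
      forall u, u != 0 -> u \in W v -> v \in W u
    & forall u L, u != 0 -> \dim L = 2%N -> (P L v <= W v -> P L u <= W u)%VS].

Lemma web_ex p E : p != 0 -> p \in E -> \dim E = 3%N ->
  exists2 W, web W & W p = E.
Proof.
move=> nzp Ep dE.
have [a Ea pa] : exists2 a, a \in E & a \notin <[p]>%VS.
  by apply: ex_notin; rewrite dE dim_vline; case: (p != 0).
have [b Eb pb] : exists2 b, b \in E & b \notin (<[p]> + <[a]>)%VS.
  by apply: ex_notin; rewrite dE dim_pair.
pose L := (<[p]> + <[a]>)%VS; pose M := (<[p]> + <[b]>)%VS.
have dL : \dim L = 2%N := dim_pair nzp pa.
have dM : \dim M = 2%N.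
  by apply: dim_pair => //; apply: contra pb; apply/subvP/addvSl.
have neqLM : L != M by apply: contraNneq pb => eqLM; rewrite -/L eqLM mem_pairr.
have neqP v : v != 0 -> P L v != P M v.
  move=> nzv; apply: contraNneq neqLM => /(par_eq_at dL dM nzv nzp).
  by rewrite !par_id ?mem_pairl // => ->.
exists (fun v => (P L v + P M v)%VS) => [v nzv|].
  split; first by rewrite (dim_lines (v := v)) ?par_dim ?par_mem ?neqP.
  - by rewrite memvE (subv_trans _ (addvSl _ _)) // -memvE par_mem.
  - by move=> u nzu; apply: crossed.
  - by move=> u N nzu dN; apply: par_coplanar.
rewrite !par_id ?mem_pairl //; apply: dim_eq_sub.
  by rewrite !subv_add -!memvE Ep Ea Eb.
by rewrite dE (dim_lines (v := p)) ?mem_pairl.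
Qed.

(** The equality at p says that the same classes belong to both webs. *)
Lemma web_eq W W' p u : web W -> web W' -> p != 0 -> u != 0 ->
  W p = W' p -> W u = W' u.
Proof.
move=> webW webW' nzp nzu eqp.
have [dWu Wu _ WuP] := webW u nzu; have [dWu' Wu' _ _] := webW' u nzu.
have [_ _ _ Wp'P] := webW' p nzp.
apply: dim_eq_sub; last by rewrite dWu dWu'.
apply/subvP => v Wv; have [/vlineP[c ->]|uv] := boolP (v \in <[u]>%VS).
  by rewrite memvZ.
pose L := (<[u]> + <[v]>)%VS; have dL : \dim L = 2%N := dim_pair nzu uv.
have PLu : P L u = L by rewrite par_id ?mem_pairl.
have sLp : (P L p <= W p)%VS by apply: WuP => //; rewrite PLu subv_add -!memvE Wu.
have := Wp'P u L nzu dL; rewrite -eqp PLu => /(_ sLp)/subvP; apply.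
exact: mem_pairr.
Qed.

(** The space is the direct sum of P L (e + x) and P L x. *)
Lemma par_transversal_ex L e x y : \dim L = 2%N -> e != 0 -> x \notin P L e ->
  exists2 z, z \in P L x & y + z \in P L (e + x).
Proof.
move=> dL nze ex; have nzx := nz_notin ex; have spL := par_spread dL.
have exx : e + x \notin P L x by have := spread_notinD spL 1 nze ex; rewrite scale1r.
have nzex := nz_notin exx.
have : y \in (P L (e + x) + P L x)%VS.
  suff -> : (P L (e + x) + P L x)%VS = {:V}%VS by exact: memvf.
  apply/eqP; rewrite eqEdim subvf dimv_disjoint_sum ?par_dim ?dimV //.
  apply/eqP; rewrite -subv0; apply/subvP => w /memv_capP[Sw Mw].
  by rewrite memv0 (spread_skew spL nzx exx Mw Sw).
case/memv_addP=> w Sw [z Mz ->]; exists (- z); first by rewrite rpredN.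
by rewrite addrK.
Qed.

(** The web is the one spanned at e by the lines <[e, y]> and <[e, z]>. As it
    contains the class of L, it contains P L v in W v for all v, and symmetry of
    webs moves memberships around the quadrangle e, x, z, y. *)
Lemma transversal_web L e x y z :
  \dim L = 2%N -> e != 0 -> x \notin P L e -> y \in P L e -> y \notin <[e]>%VS ->
  z \in P L x -> y + z \in P L (e + x) ->
  exists2 W, web W &
    forall d, d != 0 -> d \in (<[e]> + <[x]>)%VS ->
      [/\ y \in W d, z \in W d & (P L d <= W d)%VS].
Proof.
move=> dL nze ex Ly ey Lz Lyz; have nzx := nz_notin ex; have spL := par_spread dL.
have nzy := nz_notin ey.
have exe : e + x \notin P L e by rewrite rpredDl ?par_mem.
have nzex := nz_notin exe.
have nzz : z != 0.
  apply: contraNneq nzy => z0; move: Lyz; rewrite z0 addr0.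
  by move/(spread_skew spL nze exe Ly)->.
have ez : z \notin P L e.
  by apply: contraNN nzz => ez; apply/eqP/(spread_skew spL nze ex).
have [W webW We] : exists2 W, web W & W e = (P L e + <[z]>)%VS.
  apply: web_ex => //; last by rewrite dim_addline ?par_dim.
  by rewrite memvE (subv_trans _ (addvSl _ _)) // -memvE par_mem.
have [_ _ symWe parWe] := webW e nze; exists W => //.
have LW v : v != 0 -> (P L v <= W v)%VS.
  by move=> nzv; apply: parWe => //; rewrite We addvSl.
have [Wey Wez] : y \in W e /\ z \in W e.
  by rewrite We; split; [rewrite (subvP (addvSl _ _)) | rewrite memvE addvSr].
have [_ _ symWz _] := webW z nzz; have [_ _ symWy _] := webW y nzy.
have [dWex _ symWex _] := webW _ nzex.
have Wzx : x \in W z.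
  apply: (subvP (LW z nzz)); rewrite (spread_eq spL nzx nzz Lz).
  exact: par_mem.
have Wexz : z \in W (e + x) by apply: symWz; rewrite // rpredD // symWe.
have Wexy : y \in W (e + x).
  by rewrite -[y](addrK z) rpredB // (subvP (LW _ nzex)).
have Wyx : x \in W y.
  by rewrite -[x](addKr e) addrC rpredB // ?symWe // symWex.
move=> d nzd /mem_pairP[a [b dE]]; split; last exact: LW.
  by apply: symWy; rewrite // dE rpredD ?memvZ // symWe.
by apply: symWz; rewrite // dE rpredD ?memvZ // symWe.
Qed.

(** In the plane W d given by [transversal_web], the line P L d meets the
    transversal <[y, z]>. The point of intersection has the expected coordinates:
    comparing the transversals through y and through e + y gives a linear relation
    between x and z, which are independent. *)
Lemma par_regular L : \dim L = 2%N -> regular (P L).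
Proof.
move=> dL e x y nze ex Ly; have nzx := nz_notin ex; have spL := par_spread dL.
have [/vlineP[c ->]|ey] := boolP (y \in <[e]>%VS).
  exists (c *: x) => [|a b]; first by rewrite memvZ ?par_mem.
  rewrite !scalerA ![_ * c]mulrC -!scalerA -scalerDr memvZ //.
  have [->|nzd] := eqVneq (a *: e + b *: x) 0; [exact: mem0v | exact: par_mem].
have [z Lz Lyz] := par_transversal_ex y dL nze ex; exists z => // a b.
have Pscale c v w : w \in P L v -> v != 0 -> c *: w \in P L (c *: v).
  move=> Pvw nzv; have [->|nzc] := eqVneq c 0; first by rewrite scale0r mem0v.
  rewrite (@spread_eq _ _ _ spL v) ?memvZ ?par_mem //.
  by rewrite scaler_eq0 negb_or nzc.
have [a0|nza] := eqVneq a 0; first by rewrite a0 !scale0r !add0r Pscale.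
have [b0|nzb] := eqVneq b 0; first by rewrite b0 !scale0r !addr0 Pscale.
pose d := a *: e + b *: x.
have nzd : d != 0.
  apply: contraNneq ex => /eqP; rewrite /d addrC addr_eq0 => /eqP bx.
  by rewrite -(memv_scale _ _ nzb) bx rpredN memvZ ?par_mem.
have dx : d \notin P L x.
  apply: contra ex => Ldx; suff Lex : e \in P L x.
    by rewrite (spread_eq spL nzx nze Lex) par_mem.
  rewrite -(memv_scale _ _ nza) -[a *: e](addrK (b *: x)).
  by rewrite rpredB ?memvZ ?par_mem.
have exe : e + x \notin P L e by rewrite rpredDl ?par_mem.
have meet y' z' : y' \in P L e -> y' \notin <[e]>%VS -> z' \in P L x ->
    y' + z' \in P L (e + x) -> exists c, y' + c *: z' \in P L d.
  move=> Ly' ey' Lz' Lyz'; have nzy' := nz_notin ey'.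
  have [W webW WD] := transversal_web dL nze ex Ly' ey' Lz' Lyz'.
  have [|Wy' Wz' LW] := WD d nzd; first by apply/mem_pairP; exists a, b.
  have [dW _ _ _] := webW d nzd.
  have nzz' : z' != 0.
    apply: contraNneq nzy' => z0; move: Lyz'; rewrite z0 addr0 => Lyex.
    by apply/eqP/(spread_skew spL nze _ Ly' Lyex); rewrite rpredDl ?par_mem.
  have yz' : z' \notin <[y']>%VS.
    apply: contraNN nzz' => yz'; apply/eqP/(spread_skew spL nze ex) => //.
    by case/vlineP: yz' => c ->; rewrite memvZ.
  have [w [nzw Lw Tw]] : exists w, [/\ w != 0, w \in P L d & w \in (<[y']> + <[z']>)%VS].
    apply: (meet_nz LW); first by rewrite subv_add -!memvE Wy'.
    by rewrite dW par_dim // dim_pair.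
  case/mem_pairP: Tw => s [t wE].
  have nzs : s != 0.
    apply: contraNneq nzw => s0; move: Lw; rewrite wE s0 scale0r add0r => Lw.
    by apply/eqP/(spread_skew spL nzx dx _ Lw); rewrite memvZ.
  exists (t / s); rewrite -(memv_scale _ _ nzs).
  by have -> : s *: (y' + (t / s) *: z') = w by rewrite wE; lmod.
have [c Lc] := meet _ _ Ly ey Lz Lyz.
have [c' Lc'] : exists c', (e + y) + c' *: (x + z) \in P L d.
  apply: meet.
  - by rewrite rpredD ?par_mem.
  - by rewrite rpredDl ?memv_line.
  - by rewrite rpredD ?par_mem.
  have -> : e + y + (x + z) = e + x + (y + z) by lmod.
  by rewrite rpredD ?par_mem // (nz_notin exe).
have xz : z \notin <[x]>%VS.
  apply: contra ey => /vlineP[k zE]; suff /subr0_eq -> : y - k *: e = 0.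
    by rewrite memvZ ?memv_line.
  apply: (spread_skew spL nze exe); first by rewrite rpredB ?memvZ ?par_mem.
  have -> : y - k *: e = y + z - k *: (e + x) by rewrite zE; lmod.
  by rewrite rpredB ?memvZ ?par_mem ?(nz_notin exe).
have [cE c'E] : c' - b / a = 0 /\ c' - c = 0.
  apply: (pair_indep nzx xz); apply: (spread_skew spL nzx dx).
    by rewrite rpredD ?memvZ ?par_mem.
  have -> : (c' - b / a) *: x + (c' - c) *: z =
    (e + y + c' *: (x + z)) - (y + c *: z) - a^-1 *: d by rewrite /d; lmod.
  by rewrite !rpredB ?memvZ ?par_mem.
have -> : a *: y + b *: z = a *: (y + c *: z); last by rewrite memvZ.
by rewrite -(subr0_eq c'E) (subr0_eq cE); lmod.
Qed.

End ParallelFunctions.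

(** * Linear maps along the parallel classes *)

Section ClasswiseMaps.
Variables (F : fieldType) (V : vectType F).
Hypothesis dimV : \dim {:V} = 4%N.
Implicit Types (u v w p q e x y z : V) (L M N E D : {vspace V}) (W : V -> {vspace V}).
Implicit Types (f g : 'End(V)).
Variables (P : {vspace V} -> V -> {vspace V}) (parP : parallel_fun P).
Hypothesis crossed : crossed_fun P.

Definition along L f := forall v, v != 0 -> f v \in P L v.
Definition classwise f := exists2 L, \dim L = 2%N & along L f.

Lemma line_ex : exists L : {vspace V}, \dim L = 2%N.
Proof.
have [u _ nzu] : exists2 u, u \in {:V}%VS & u \notin 0%VS.
  by apply: ex_notin; rewrite dimv0 dimV.
have [v _ uv] : exists2 v, v \in {:V}%VS & v \notin <[u]>%VS.
  by apply: ex_notin; rewrite dim_vline dimV; case: (u != 0).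
by exists (<[u]> + <[v]>)%VS; rewrite dim_pair // -memv0.
Qed.

Lemma along_scalar L c : \dim L = 2%N -> along L (c *: \1%VF).
Proof. by move=> dL v nzv; rewrite !lfun_simp memvZ ?(par_mem parP). Qed.

Lemma along_comp L f g : \dim L = 2%N -> along L f -> along L g -> along L (f \o g)%VF.
Proof.
move=> dL Lf Lg v nzv; rewrite lfun_simp.
have [->|nzgv] := eqVneq (g v) 0; first by rewrite linear0 mem0v.
by rewrite -(spread_eq (par_spread parP dL) nzv nzgv (Lg v nzv)) Lf.
Qed.

Lemma along_affine L f s t : \dim L = 2%N -> along L f -> along L (s *: \1%VF + t *: f).
Proof.
move=> dL Lf v nzv; rewrite add_lfunE rpredD ?along_scalar //.
by rewrite scale_lfunE memvZ ?Lf.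
Qed.

Lemma along_ex L e y : \dim L = 2%N -> e != 0 -> y \in P L e ->
  exists2 f, along L f & f e = y.
Proof.
move=> dL nze Ly.
have [f fe Lf] := regular_spread_lfun dimV (par_spread parP dL)
  (par_regular dimV parP crossed dL) nze Ly.
by exists f.
Qed.

Lemma classwise_ex e y : e != 0 -> exists2 f, classwise f & f e = y.
Proof.
move=> nze; have [/vlineP[c ->]|ey] := boolP (y \in <[e]>%VS).
  have [L dL] := line_ex; exists (c *: \1%VF); last by rewrite !lfun_simp.
  by exists L => //; apply: along_scalar.
have dL := dim_pair nze ey.
have [|f Lf fe] := @along_ex _ e y dL nze; first by rewrite (par_id parP) ?mem_pairl ?mem_pairr.
by exists f => //; exists (<[e]> + <[y]>)%VS.
Qed.

Lemma along_inj L f g e : \dim L = 2%N -> along L f -> along L g -> e != 0 ->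
  f e = g e -> f = g.
Proof. by move=> dL Lf Lg; apply: (spread_lfun_inj dimV (par_spread parP dL)). Qed.

Lemma classwise_scalar f e c : classwise f -> e != 0 -> f e = c *: e -> f = c *: \1%VF.
Proof.
case=> L dL Lf nze fe; apply: (along_inj dL Lf (along_scalar c dL) nze).
by rewrite fe !lfun_simp.
Qed.

Lemma classwise_along f L e : \dim L = 2%N -> classwise f -> e != 0 ->
  f e \notin <[e]>%VS -> f e \in P L e -> along L f.
Proof.
move=> dL [M dM Mf] nze fe Lfe v nzv.
rewrite (par_eq_at parP dL dM nze nzv) ?Mf //.
rewrite (line_pairE (par_dim parP dL nze) (par_mem parP dL nze) Lfe nze fe).
by rewrite (line_pairE (par_dim parP dM nze) (par_mem parP dM nze) (Mf e nze) nze fe).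
Qed.

(** If f e is not a multiple of e, then f and g go along the same class, namely
    the one of the line <[e, f e]>. *)
Lemma classwise_inj f g e : classwise f -> classwise g -> e != 0 -> f e = g e -> f = g.
Proof.
move=> Cf Cg nze fge; have [/vlineP[c fe]|fe] := boolP (f e \in <[e]>%VS).
  by rewrite (classwise_scalar Cf nze fe) (classwise_scalar Cg nze (c := c)) // -fge.
have [L dL Lf] := Cf; apply: (along_inj dL Lf _ nze fge).
by apply: (classwise_along dL Cg nze); rewrite -fge ?Lf.
Qed.

Lemma classwise_neq0 f e v : classwise f -> e != 0 -> f e != 0 -> v != 0 -> f v != 0.
Proof.
move=> Cf nze fe nzv; apply: contraNneq fe => fv.
by rewrite (@classwise_scalar _ v 0 Cf nzv) ?scale0r ?lfunE.
Qed.

Lemma classwise_affine f s t : classwise f -> classwise (s *: \1%VF + t *: f).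
Proof. by case=> L dL Lf; exists L => //; apply: along_affine. Qed.

Lemma classwise_dim f e D : classwise f -> e != 0 -> f e != 0 -> \dim (f @: D) = \dim D.
Proof.
move=> Cf nze fe; apply: limg_dim_eq; apply/eqP; rewrite -subv0; apply/subvP => v.
rewrite memv_cap memv_ker memv0 => /andP[_]; apply: contraLR => nzv.
exact: (classwise_neq0 Cf nze).
Qed.

(** * The opposite parallelism *)

Lemma img_stable f D d : \dim D = 2%N -> classwise f -> d != 0 -> d \in D -> f d \in D ->
  f d != 0 -> (f @: D)%VS = D.
Proof.
move=> dD Cf nzd Dd Dfd nzfd; apply: dim_eq_sub; last by rewrite (classwise_dim _ Cf nzd).
have [/vlineP[c fd]|fd] := boolP (f d \in <[d]>%VS).
  rewrite (classwise_scalar Cf nzd fd); apply/subvP => _ /memv_imgP[u Du ->].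
  by rewrite !lfun_simp memvZ.
have Df : along D f.
  by apply: (classwise_along dD Cf nzd fd); rewrite (par_id parP).
apply/subvP => _ /memv_imgP[u Du ->]; have [->|nzu] := eqVneq u 0.
  by rewrite linear0 mem0v.
by rewrite -(par_id parP dD nzu Du) Df.
Qed.

(** The classes of the lines joining D to a point v off D form a line of the plane
    of classes, hence a web W with W v = D + <[v]>. By [transversal_web] the
    image of D under a classwise map taking d to v lies in all planes W u. *)
Lemma img_web f D d : \dim D = 2%N -> classwise f -> d != 0 -> d \in D -> f d \notin D ->
  exists2 W, web P W &
    W (f d) = (D + <[f d]>)%VS /\ forall u, u != 0 -> u \in D -> (f @: D <= W u)%VS.
Proof.
move=> dD Cf nzd Dd Dv; have nzv := nz_notin Dv; set v := f d in Dv nzv *.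
have [x Dx dx] : exists2 x, x \in D & x \notin <[d]>%VS.
  by apply: ex_notin; rewrite dD dim_vline nzd.
have DE := line_pairE dD Dd Dx nzd dx.
have [L dL Lf] := Cf; have Lv : v \in P L d := Lf d nzd.
have dv : v \notin <[d]>%VS by apply: contra Dv => /vlineP[c ->]; rewrite memvZ.
have Lx : x \notin P L d.
  rewrite (line_pairE (par_dim parP dL nzd) (par_mem parP dL nzd) Lv nzd dv).
  apply: contra dx => /mem_pairP[a [b xE]]; have [b0|nzb] := eqVneq b 0.
    by rewrite xE b0 scale0r addr0 memvZ ?memv_line.
  case/negP: Dv; rewrite -(memv_scale _ _ nzb) -[b *: v](addKr (a *: d)) -xE.
  by rewrite rpredD ?rpredN ?memvZ.
have nzx := nz_notin Lx.
have nzdx : d + x != 0.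
  by apply: (nz_notin (L := P L d)); rewrite rpredDl ?(par_mem parP).
have [||W webW WD] := transversal_web dimV parP crossed dL nzd Lx Lv dv (z := f x).
- exact: Lf.
- by rewrite -linearD Lf.
exists W => //; have [dW Wv symWv _] := webW v nzv.
have WDv u : u != 0 -> u \in D -> (f @: D <= W u)%VS.
  move=> nzu Du; have [|Wuv Wuz _] := WD u nzu; first by rewrite -DE.
  by rewrite DE limgD !limg_line subv_add -!memvE Wuv.
split=> //; apply/esym/dim_eq_sub; last by rewrite dim_addline // dD dW.
rewrite subv_add -memvE Wv andbT; apply/subvP => u Du.
have [->|nzu] := eqVneq u 0; first exact: mem0v.
have [_ _ symWu _] := webW u nzu; apply: symWu => //.
by rewrite (subvP (WDv u nzu Du)) ?memv_img.
Qed.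

(** The image of D through v, when v is off D, is the intersection of two planes
    of the web determined by D and v. *)
Lemma img_unique f g D d d' : \dim D = 2%N -> classwise f -> classwise g ->
  d != 0 -> d \in D -> d' != 0 -> d' \in D -> f d != 0 -> f d = g d' ->
  (f @: D)%VS = (g @: D)%VS.
Proof.
move=> dD Cf Cg nzd Dd nzd' Dd' nzv fgd; have [Dv|Dv] := boolP (f d \in D).
  by rewrite (img_stable dD Cf nzd Dd) // (img_stable dD Cg nzd' Dd') -?fgd.
have [W webW [Wv WD]] := img_web dD Cf nzd Dd Dv.
have Dv' := Dv; rewrite fgd in Dv'.
have [W' webW' [Wv' WD']] := img_web dD Cg nzd' Dd' Dv'.
have eqW u : u != 0 -> W' u = W u.
  by move=> nzu; apply: (web_eq parP webW' webW nzv nzu); rewrite {1}fgd Wv' Wv fgd.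
have [x Dx dx] : exists2 x, x \in D & x \notin <[d]>%VS.
  by apply: ex_notin; rewrite dD dim_vline nzd.
have nzx := nz_notin dx; have DE := line_pairE dD Dd Dx nzd dx.
have [dWd Wdd _ _] := webW d nzd; have [dWx Wxx _ _] := webW x nzx.
have dfD : \dim (f @: D) = 2%N by rewrite (classwise_dim _ Cf nzd).
have dgD : \dim (g @: D) = 2%N by rewrite (classwise_dim _ Cg nzd') // -fgd.
have nWdx : W d != W x.
  apply: contraNneq Dv => eqdx.
  have [u [nzu Du /memv_imgP[u' Du' uE]]] : exists u, [/\ u != 0, u \in D & u \in (f @: D)%VS].
    apply: (@meet_nz _ _ _ _ (W d)); rewrite ?WD ?dWd ?dD ?dfD //.
    by rewrite DE subv_add -!memvE Wdd eqdx.
  have nzu' : u' != 0 by apply: contraNneq nzu => u'0; rewrite uE u'0 linear0.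
  by rewrite -(img_stable dD Cf nzu' Du') -?uE // memv_img.
have dWW : (\dim (W d :&: W x) <= 2)%N.
  rewrite -ltnS -dWd ltn_neqAle dimvS ?capvSl // andbT.
  apply: contra nWdx => /eqP eqd.
  have/eqP <- : (W d :&: W x)%VS == W d by rewrite eqEdim capvSl eqd leqnn.
  by rewrite eqEdim capvSr eqd dWx dWd.
have imgE T : \dim T = 2%N -> (T <= W d)%VS -> (T <= W x)%VS -> T = (W d :&: W x)%VS.
  by move=> dT Td Tx; apply: dim_eq_sub; rewrite ?dT // subv_cap Td.
rewrite (imgE (f @: D)%VS) ?WD // (imgE (g @: D)%VS) //.
  by rewrite -eqW ?WD'.
by rewrite -eqW ?WD'.
Qed.

(** In this section J e y is a choice of the classwise map sending e to y. If
    classwise maps are right multiplications, then opposite-parallel lines are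
    right parallel. *)
Section OppositeParallelism.
Variable J : V -> V -> 'End(V).
Hypothesis J_classwise : forall e y, e != 0 -> classwise (J e y).
Hypothesis J_eval : forall e y, e != 0 -> J e y e = y.

(** By [opposite_img] any nonzero vector of D may replace the chosen one. *)
Definition opposite D v : {vspace V} := (J (vpick D) v @: D)%VS.

Lemma pick_nz D : \dim D = 2%N -> vpick D != 0.
Proof. by move=> dD; rewrite vpick0 -dimv_eq0 dD. Qed.

Lemma opposite_img f D d : \dim D = 2%N -> classwise f -> d != 0 -> d \in D ->
  f d != 0 -> opposite D (f d) = (f @: D)%VS.
Proof.
move=> dD Cf nzd Dd nzfd; have nzD := pick_nz dD.
by apply: (img_unique (d := vpick D) (d' := d)); rewrite ?J_eval ?memv_pick //; apply: J_classwise.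
Qed.

Lemma classwise1 : classwise \1%VF.
Proof.
have [L dL] := line_ex; exists L => //.
by have := along_scalar 1 dL; rewrite scale1r.
Qed.

Lemma opposite_dim D v : \dim D = 2%N -> v != 0 -> \dim (opposite D v) = 2%N.
Proof.
move=> dD nzv; have nzD := pick_nz dD.
by rewrite (classwise_dim _ (J_classwise v nzD) nzD) ?J_eval.
Qed.

Lemma opposite_mem D v : \dim D = 2%N -> v != 0 -> v \in opposite D v.
Proof.
by move=> dD nzv; have nzD := pick_nz dD; rewrite -{1}[v](J_eval v nzD) memv_img ?memv_pick.
Qed.

Lemma opposite_id D v : \dim D = 2%N -> v != 0 -> v \in D -> opposite D v = D.
Proof.
move=> dD nzv Dv; have := opposite_img dD classwise1 nzv Dv.
rewrite id_lfunE => -> //; apply: dim_eq_sub.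
  by apply/subvP => _ /memv_imgP[u Du ->]; rewrite id_lfunE.
by rewrite (classwise_dim _ classwise1 nzv) // id_lfunE.
Qed.

Lemma opposite_eq_mem D w v : \dim D = 2%N -> w != 0 -> v != 0 ->
  v \in opposite D w -> opposite D v = opposite D w.
Proof.
move=> dD nzw nzv /memv_imgP[d Dd vE]; have nzD := pick_nz dD.
have nzd : d != 0 by apply: contraNneq nzv => d0; rewrite vE d0 linear0.
by rewrite vE opposite_img // -?vE //; apply: J_classwise.
Qed.

(** Transitivity. The main case is that of lines D, T and T', the latter two through
    points w and v off D. If the webs determined by D, w and by D, v agree, then T
    and T' lie in a common plane, hence meet, hence are equal. If the webs differ,
    their planes at a point e of D meet in a line N, which meets both
    T and T'. The classwise maps f0, f1 and f2 sending e to t, e to t' and t to t',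
    with t and t' on N, go along the class of N, so f1 is the composite of f0 and
    f2, and f2 carries T to T'. *)
Lemma opposite_opposite D w v : \dim D = 2%N -> w != 0 -> v != 0 ->
  opposite (opposite D w) v = opposite D v.
Proof.
move=> dD nzw nzv; set T := opposite D w; set e := vpick D.
have nze : e != 0 := pick_nz dD; have De : e \in D := memv_pick D.
have dT : \dim T = 2%N := opposite_dim dD nzw.
have [Tv|Tv] := boolP (v \in T); first by rewrite opposite_id // (opposite_eq_mem _ nzw).
have [Dw|Dw] := boolP (w \in D); first by rewrite /T (opposite_id dD nzw Dw).
have [Dv|Dv] := boolP (v \in D).
  (* with g D = T, a classwise map undoing g at v undoes g and carries T to D *)
  rewrite (opposite_id dD nzv Dv); pose g := J e w.
  have Cg : classwise g by exact: J_classwise.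
  have nzge : g e != 0 by rewrite J_eval.
  have nzgv : g v != 0 := classwise_neq0 Cg nze nzge nzv.
  have [L dL Lg] := Cg.
  have Lgv : v \in P L (g v).
    rewrite (spread_eq (par_spread parP dL) nzv nzgv (Lg v nzv)).
    exact: (par_mem parP).
  have [f Lf fgv] := along_ex dL nzgv Lgv.
  have fg1 : (f \o g)%VF = \1%VF.
    apply: (along_inj dL (along_comp dL Lf Lg) _ nzv); last by rewrite comp_lfunE fgv id_lfunE.
    by have := along_scalar 1 dL; rewrite scale1r.
  have Cf : classwise f by exists L.
  have fv : f (g v) != 0 by rewrite fgv.
  rewrite -[in LHS]fgv (opposite_img dT Cf nzgv) ?memv_img //.
  apply: dim_eq_sub; last by rewrite (classwise_dim _ Cf nzgv) ?dT ?dD.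
  apply/subvP => _ /memv_imgP[_ /memv_imgP[u Du ->] ->].
  by rewrite -comp_lfunE fg1 id_lfunE.
pose T' := opposite D v; have dT' : \dim T' = 2%N := opposite_dim dD nzv.
have CJw : classwise (J e w) by exact: J_classwise.
have CJv : classwise (J e v) by exact: J_classwise.
have [|W1 web1 [_ W1D]] := img_web dD CJw nze De; first by rewrite J_eval.
have [|W2 web2 [_ W2D]] := img_web dD CJv nze De; first by rewrite J_eval.
have [dW1 W1e _ _] := web1 e nze; have [dW2 W2e _ _] := web2 e nze.
have [eqW|neqW] := eqVneq (W1 e) (W2 e).
  have [u [nzu Tu Tu']] : exists u, [/\ u != 0, u \in T & u \in T'].
    by apply: (@meet_nz _ _ _ _ (W1 e)); rewrite ?W1D ?dT ?dT' ?dW1 // eqW W2D.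
  have TT' : T = T'.
    by rewrite -[T](opposite_eq_mem dD nzw nzu Tu) (opposite_eq_mem dD nzv nzu Tu').
  by rewrite TT' opposite_id // opposite_mem.
pose N := (W1 e :&: W2 e)%VS; have dN : \dim N = 2%N.
  apply/eqP; rewrite eqn_leq; apply/andP; split.
    rewrite -ltnS -dW1 ltn_neqAle dimvS ?capvSl // andbT.
    apply: contra neqW => /eqP eqd.
    have/eqP <- : N == W1 e by rewrite eqEdim capvSl eqd leqnn.
    by rewrite eqEdim capvSr eqd dW1 dW2.
  have := dimvS (subvf (W1 e + W2 e)%VS); rewrite dimV.
  by rewrite -(leq_add2r (\dim N)) dimv_sum_cap dW1 dW2 (leq_add2l 4 2).
have Ne : e \in N by rewrite memv_cap W1e.
have [t [nzt Nt Tt]] : exists t, [/\ t != 0, t \in N & t \in T].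
  by apply: (@meet_nz _ _ _ _ (W1 e)); rewrite ?W1D ?capvSl ?dN ?dT ?dW1.
have [t' [nzt' Nt' Tt']] : exists t', [/\ t' != 0, t' \in N & t' \in T'].
  by apply: (@meet_nz _ _ _ _ (W2 e)); rewrite ?W2D ?capvSr ?dN ?dT' ?dW2.
have PN u : u != 0 -> u \in N -> P N u = N by apply: (par_id parP).
have [f0 Nf0 f0e] : exists2 f, along N f & f e = t by apply: along_ex; rewrite ?PN.
have [f1 Nf1 f1e] : exists2 f, along N f & f e = t' by apply: along_ex; rewrite ?PN.
have [f2 Nf2 f2t] : exists2 f, along N f & f t = t' by apply: along_ex; rewrite ?PN.
have C0 : classwise f0 by exists N.
have C1 : classwise f1 by exists N.
have C2 : classwise f2 by exists N.
have f20 : (f2 \o f0)%VF = f1.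
  apply: (along_inj dN (along_comp dN Nf2 Nf0) Nf1 nze).
  by rewrite comp_lfunE f0e f2t.
have TE : T = (f0 @: D)%VS.
  by rewrite -(opposite_img dD C0 nze De) f0e // (opposite_eq_mem dD nzw nzt Tt).
have TE' : T' = (f1 @: D)%VS.
  by rewrite -(opposite_img dD C1 nze De) f1e // (opposite_eq_mem dD nzv nzt' Tt').
have f2T : (f2 @: T)%VS = T'.
  apply: dim_eq_sub; last by rewrite (classwise_dim _ C2 nzt) ?f2t ?dT ?dT'.
  rewrite TE TE'; apply/subvP => _ /memv_imgP[_ /memv_imgP[u Du ->] ->].
  by rewrite -comp_lfunE f20 memv_img.
have : v \in T' by exact: opposite_mem.
rewrite -{1}f2T => /memv_imgP[a Ta vE].
have nza : a != 0 by apply: contraNneq nzv => a0; rewrite vE a0 linear0.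
by rewrite -/T' -f2T {1}vE (opposite_img dT C2 nza Ta) // -vE.
Qed.

Lemma opposite_parallel_fun : parallel_fun opposite.
Proof.
split; [exact: opposite_dim | exact: opposite_mem | exact: opposite_id |].
exact: opposite_opposite.
Qed.

(** If f is classwise and takes a to b, then it takes the line through a to the line
    through b, and s + t f does the same for s a + t b. *)
Lemma opposite_regular D : \dim D = 2%N -> regular (opposite D).
Proof.
move=> dD a b y nza Ta Ty; have nzb := nz_notin Ta.
set T := opposite D a in Ta Ty *; have dT : \dim T = 2%N := opposite_dim dD nza.
have Taa : a \in T := opposite_mem dD nza.
pose f := J a b; have Cf : classwise f by exact: J_classwise.
have fa : f a = b by exact: J_eval.
have oppE v : v != 0 -> opposite D v = opposite T v.
  by move=> nzv; rewrite opposite_opposite.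
exists (f y); first by rewrite oppE // -{1}fa (opposite_img dT Cf nza Taa) ?fa // memv_img.
move=> s t; pose g := s *: \1%VF + t *: f.
have gE v : g v = s *: v + t *: f v by rewrite !lfun_simp.
have Cg : classwise g by exact: classwise_affine.
have ab : b \notin <[a]>%VS by apply: contra Ta => /vlineP[c ->]; rewrite memvZ.
rewrite -fa -!gE; have [ga0|nzga] := eqVneq (g a) 0.
  have [s0 t0] : s = 0 /\ t = 0 by apply: (pair_indep nza ab); rewrite -fa -gE.
  by rewrite gE s0 t0 !scale0r addr0 mem0v.
by rewrite (oppE _ nzga) (opposite_img dT Cg nza Taa) // memv_img.
Qed.

Definition along_opposite D g := forall v, v != 0 -> g v \in opposite D v.

Lemma along_opposite_ex D e x : \dim D = 2%N -> e != 0 -> x \in opposite D e ->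
  exists2 g, along_opposite D g & g e = x.
Proof.
move=> dD nze Dx.
have [g ge Dg] := regular_spread_lfun dimV (par_spread opposite_parallel_fun dD)
  (opposite_regular dD) nze Dx.
by exists g.
Qed.

(** Let x = g u and y = f u. Opposite-parallelism puts g y on the image <[y, f x]>
    of <[u, x]> under f, and likewise g (u + y) on its image under 1 + f. Since
    u, y, x, f x are independent, linearity of g leaves only g y = f x. *)
Lemma commute_at D f g u : \dim D = 2%N -> classwise f -> along_opposite D g ->
  u != 0 -> g u \notin (<[u]> + <[f u]>)%VS -> f (g u) = g (f u).
Proof.
move=> dD Cf Dg nzu gu; have [/vlineP[c fu]|fu] := boolP (f u \in <[u]>%VS).
  by rewrite fu (classwise_scalar Cf nzu fu) !lfun_simp linearZ.
have [L dL Lf] := Cf; pose x := g u; pose y := f u; pose z := f x.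
have ux : x \notin <[u]>%VS by apply: contra gu; apply/subvP/addvSl.
have nzx := nz_notin ux; have nzy : y != 0 := nz_notin fu.
have Lu := line_pairE (par_dim parP dL nzu) (par_mem parP dL nzu) (Lf u nzu) nzu fu.
have Lx : x \notin P L u by rewrite Lu.
have nzz : z != 0 := classwise_neq0 Cf nzu nzy nzx.
have xz : z \notin <[x]>%VS.
  by apply: contra fu => /vlineP[c fx]; rewrite (classwise_scalar Cf nzx fx) !lfun_simp memvZ ?memv_line.
have sk := spread_skew (par_spread parP dL) nzu Lx.
pose D' := opposite D u; have dD' : \dim D' = 2%N := opposite_dim dD nzu.
have Du : u \in D' := opposite_mem dD nzu.
have D'E : D' = (<[u]> + <[x]>)%VS := line_pairE dD' Du (Dg u nzu) nzu ux.
have oppE h : classwise h -> h u != 0 -> opposite D (h u) = (<[h u]> + <[h x]>)%VS.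
  move=> Ch nzhu; rewrite -(opposite_opposite dD nzu nzhu) (opposite_img dD' Ch nzu) //.
  by rewrite -/D' D'E limgD !limg_line.
have /mem_pairP[c [d gyE]] : g y \in (<[y]> + <[z]>)%VS by rewrite -oppE ?Dg.
pose h := 1 *: \1%VF + 1 *: f.
have hE v : h v = v + f v by rewrite !lfun_simp !scale1r.
have nzhu : h u != 0.
  rewrite hE; apply: contraNneq fu => /eqP; rewrite addr_eq0 => /eqP uE.
  by rewrite -memvN -uE memv_line.
have /mem_pairP[a [b]] : g (h u) \in (<[h u]> + <[h x]>)%VS.
  by rewrite -oppE ?Dg //; apply: classwise_affine.
rewrite !hE linearD /= -/x -/y -/z gyE => eqs.
have S0 : (1 - b) *: x + (d - b) *: z = a *: u + (a - c) *: y.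
  apply/subr0_eq; move/eqP: eqs; rewrite -subr_eq0 => /eqP; move=> <-; lmod.
have Sx0 : (1 - b) *: x + (d - b) *: z = 0.
  apply: sk; last by rewrite rpredD ?memvZ ?Lf ?(par_mem parP).
  by rewrite S0 rpredD ?memvZ ?Lf ?(par_mem parP).
have [/subr0_eq b1 /subr0_eq db] := pair_indep nzx xz Sx0.
have [a0 /eqP] := pair_indep nzu fu (etrans (esym S0) Sx0).
rewrite a0 sub0r oppr_eq0 => /eqP c0.
by rewrite -/z c0 db -b1 scale0r scale1r add0r.
Qed.

Lemma JZ e c y : e != 0 -> J e (c *: y) = c *: J e y.
Proof.
move=> nze; apply: (classwise_inj _ _ nze); first exact: J_classwise.
  have := classwise_affine 0 c (J_classwise y nze).
  by rewrite scale0r add0r.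
by rewrite scale_lfunE !J_eval.
Qed.

(** For x outside the span of e, y1, y2 let g be a linear map along the opposite
    parallelism with g e = x. Then J e y x = g y for y = y1, y2, y1 + y2, by
    commutation at e. *)
Lemma JD e y1 y2 : e != 0 -> J e (y1 + y2) = J e y1 + J e y2.
Proof.
move=> nze; apply: (@eq_lfun_off _ _ _ _ <<[:: e; y1; y2]>>%VS).
  by rewrite dimV ltnS dim_span.
move=> x Ux; have [Ue U1 U2] : [/\ e \in <<[:: e; y1; y2]>>%VS,
    y1 \in <<[:: e; y1; y2]>>%VS & y2 \in <<[:: e; y1; y2]>>%VS].
  by split; rewrite memv_span // !inE eqxx ?orbT.
have ex : x \notin <[e]>%VS by apply: contra Ux => /vlineP[c ->]; rewrite memvZ.
pose D := (<[e]> + <[x]>)%VS; have dD : \dim D = 2%N := dim_pair nze ex.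
have [|g Dg ge] := @along_opposite_ex D e x dD nze.
  by rewrite opposite_id ?mem_pairl ?mem_pairr.
have JE y : y \in <<[:: e; y1; y2]>>%VS -> J e y x = g y.
  move=> Uy; rewrite -ge (commute_at dD (J_classwise y nze) Dg nze) ?J_eval //.
  by rewrite ge; apply: contra Ux => /mem_pairP[a [b ->]]; rewrite rpredD ?memvZ.
by rewrite add_lfunE !JE ?linearD ?rpredD.
Qed.

(** Additivity in w extends the commutation of J u w and g to the exceptional w,
    those in the span of u and g u. *)
Lemma J_along_opposite D g u w : \dim D = 2%N -> along_opposite D g -> u != 0 ->
  g u \notin <[u]>%VS -> J u w (g u) = g w.
Proof.
move=> dD Dg nzu gu; pose U := (<[u]> + <[g u]>)%VS.
have JE w' : w' \notin U -> J u w' (g u) = g w'.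
  move=> Uw'; rewrite (commute_at dD (J_classwise w' nzu) Dg nzu) ?J_eval //.
  by apply: contra Uw'; apply: pair_exchange.
have [Uw|/JE//] := boolP (w \in U).
have [v _ Uv] : exists2 v, v \in {:V}%VS & v \notin U.
  by apply: ex_notin; rewrite dimV dim_pair.
have := JE (w + v); rewrite rpredDl // => /(_ Uv).
by rewrite (JD _ _ nzu) add_lfunE linearD /= (JE v Uv) => /addIr.
Qed.

(** With g as a left multiplication by x, both sides equal g (J e z y): on the left
    J e z may be rewritten as J y (J e z y), which commutes with g at y. *)
Lemma J_assoc e x y z : e != 0 -> J e z (J e y x) = J e (J e z y) x.
Proof.
move=> nze; have [/vlineP[c ->]|ex] := boolP (x \in <[e]>%VS).
  by rewrite !linearZ /= !J_eval.
have [->|nzy] := eqVneq y 0.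
  have J0 : J e 0 = 0 by rewrite -[X in J e X](scale0r 0) JZ // scale0r.
  by rewrite linear0 J0 !zero_lfunE linear0.
pose D := (<[e]> + <[x]>)%VS; have dD : \dim D = 2%N := dim_pair nze ex.
have [|g Dg ge] := @along_opposite_ex D e x dD nze.
  by rewrite opposite_id ?mem_pairl ?mem_pairr.
have gu u : u != 0 -> g u \notin <[u]>%VS.
  move=> nzu; apply: contra ex => /vlineP[c gu]; rewrite -ge.
  have -> : g = c *: \1%VF.
    apply: (spread_lfun_inj dimV (par_spread opposite_parallel_fun dD) Dg _ nzu).
      by move=> v nzv; rewrite !lfun_simp memvZ ?opposite_mem.
    by rewrite gu !lfun_simp.
  by rewrite !lfun_simp memvZ ?memv_line.
have JE w : J e w x = g w by rewrite -ge (J_along_opposite w dD Dg nze (gu e nze)).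
have JzE : J e z = J y (J e z y).
  by apply: (classwise_inj _ _ nzy); rewrite ?J_eval //; apply: J_classwise.
by rewrite !JE {1}JzE (J_along_opposite _ dD Dg nzy (gu y nzy)).
Qed.

Lemma J_quadratic e x : e != 0 -> J e x x \in (<[e]> + <[x]>)%VS.
Proof.
move=> nze; have [/vlineP[c ->]|ex] := boolP (x \in <[e]>%VS).
  by rewrite linearZ /= J_eval // scalerA memvE (subv_trans _ (addvSl _ _)) // -memvE memvZ ?memv_line.
have nzx := nz_notin ex; have dL := dim_pair nze ex.
have Lf : along (<[e]> + <[x]>) (J e x).
  apply: (classwise_along dL (J_classwise x nze) nze); rewrite J_eval //.
  by rewrite (par_id parP) ?mem_pairl ?mem_pairr.
by have := Lf x nzx; rewrite (par_id parP dL nzx) ?mem_pairr.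
Qed.

Lemma J_neq0 e v x : e != 0 -> v != 0 -> x != 0 -> J e v x != 0.
Proof.
move=> nze nzv nzx; apply: (classwise_neq0 (J_classwise v nze) nze _ nzx).
by rewrite J_eval.
Qed.

(** In terms of the product of x and y given by J e y x: left multiplication by x
    takes a line M to a parallel line. *)
Lemma J_parallel e M u v x : \dim M = 2%N -> e != 0 -> v != 0 -> x != 0 ->
  u \in M -> v \in M -> J e u x \in P M (J e v x).
Proof.
move=> dM nze nzv nzx Mu Mv.
have [f Mf fv] : exists2 f, along M f & f v = u by apply: along_ex; rewrite ?(par_id parP).
have Cf : classwise f by exists M.
have fE : f = J e (f e).
  by apply: (classwise_inj Cf _ nze); rewrite ?J_eval //; apply: J_classwise.
rewrite -fv {1}fE -J_assoc // -fE.
by apply: Mf; apply: J_neq0.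
Qed.

End OppositeParallelism.

Lemma J_ex : exists J : V -> V -> 'End(V),
  forall e y, e != 0 -> classwise (J e y) /\ J e y e = y.
Proof.
have /functional_choice[J JP] : forall ey : V * V, exists f : 'End(V),
    ey.1 != 0 -> classwise f /\ f ey.1 = ey.2.
  case=> e y /=; have [->|nze] := eqVneq e 0; first by exists 0.
  by have [f Cf fe] := classwise_ex y nze; exists f.
by exists (fun e y => J (e, y)) => e y nze; apply: JP (e, y) nze.
Qed.

End ClasswiseMaps.

(** * Algebras from bilinear products *)

Record algebra_law (F : fieldType) (V : vectType F) := AlgebraLaw {
  law_mul :> V -> V -> V;
  law_one : V;
  law_mulA : associative law_mul;
  law_mul1l : left_id law_one law_mul;
  law_mul1r : right_id law_one law_mul;
  law_mulDl : left_distributive law_mul +%R;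
  law_mulDr : right_distributive law_mul +%R;
  law_scaleAl : forall a x y, a *: law_mul x y = law_mul (a *: x) y;
  law_scaleAr : forall a x y, a *: law_mul x y = law_mul x (a *: y);
  law_one_neq0 : law_one != 0
}.

(** An alias of V that carries the algebra structure given by m. *)
Definition algebra_of (F : fieldType) (V : vectType F) (m : algebra_law V) : Type := V.

Section AlgebraOf.
Variables (F : fieldType) (V : vectType F) (m : algebra_law V).
HB.instance Definition _ := Vector.copy (algebra_of m) V.
HB.instance Definition _ := GRing.Zmodule_isNzRing.Build (algebra_of m)
  (law_mulA m) (law_mul1l m) (law_mul1r m) (law_mulDl m) (law_mulDr m) (law_one_neq0 m).
HB.instance Definition _ := GRing.Lmodule_isLalgebra.Build F (algebra_of m) (law_scaleAl m).
HB.instance Definition _ := GRing.Lalgebra_isAlgebra.Build F (algebra_of m) (law_scaleAr m).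
HB.instance Definition _ := Algebra_isFalgebra.Build F (algebra_of m).
End AlgebraOf.

(** * Quadratic division algebras of dimension four *)

Section Classification.
Variables (F : fieldType) (H : falgType F).
Hypothesis dimH : \dim {:H} = 4%N.
Hypothesis divH : division_algebra H.
Hypothesis quadH : forall x : H, x * x \in (<[1]> + <[x]>)%VS.
Implicit Types (x y z : H).

Lemma quadratic_aspace z : is_aspace (<[1]> + <[z]>)%VS.
Proof.
rewrite /is_aspace has_algid1 ?mem_pairl //=; apply/prodvP => _ _ /mem_pairP[a [b ->]] /mem_pairP[c [d ->]].
rewrite mulrDl !mulrDr -!scalerAl -!scalerAr !mul1r mulr1.
by rewrite !rpredD ?memvZ ?mem_pairl ?mem_pairr ?quadH.
Qed.

(** The span of 1 and z is a field over which H is a right vector space, so 1 and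
    any x outside that field are independent over it. *)
Lemma subfield_indep x z (a b c d : F) : z \notin 1%VS -> x \notin (<[1]> + <[z]>)%VS ->
  a *: 1 + b *: z + (c *: x + d *: (x * z)) = 0 -> [/\ a = 0, b = 0, c = 0 & d = 0].
Proof.
move=> z1 xz; set K := (<[1]> + <[z]>)%VS in xz; pose k := c *: 1 + d *: z.
have Kk : k \in K by rewrite rpredD ?memvZ ?mem_pairl ?mem_pairr.
have -> : c *: x + d *: (x * z) = x * k by rewrite mulrDr -!scalerAr mulr1.
have [k0|nzk] := eqVneq k 0.
  rewrite k0 mulr0 addr0 => /(pair_indep (oner_neq0 H) z1)[-> ->].
  by have [-> ->] := pair_indep (oner_neq0 H) z1 k0.
move/eqP; rewrite addrC addr_eq0 => /eqP xk; case/negP: xz.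
rewrite -(mulrK (divH nzk) x) xk; pose A : {aspace H} := ASpace (quadratic_aspace z).
suff : - (a *: 1 + b *: z) / k \in A by [].
by rewrite memvM ?memvV ?rpredN // rpredD ?memvZ ?mem_pairl ?mem_pairr.
Qed.

Lemma subfield_basis x z : z \notin 1%VS -> x \notin (<[1]> + <[z]>)%VS ->
  {:H}%VS = ((<[1]> + <[z]>) + (<[x]> + <[x * z]>))%VS.
Proof.
move=> z1 xz; apply/esym/eqP; rewrite eqEdim subvf dimv_disjoint_sum; last first.
  apply/eqP; rewrite -subv0; apply/subvP => w.
  rewrite memv_cap => /andP[/mem_pairP[a [b wE]] /mem_pairP[c [d]]].
  rewrite wE => eqw; rewrite memv0.
  have [|-> -> _ _] := @subfield_indep x z a b (- c) (- d) z1 xz.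
    by rewrite !scaleNr -opprD -eqw subrr.
  by rewrite !scale0r addr0.
have x1 : x != 0 := nz_notin xz.
rewrite !dim_pair ?oner_neq0 ?dimH //.
apply/negP => /vlineP[c xzE].
have [|_ _ _ /eqP] := @subfield_indep x z 0 0 (- c) 1 z1 xz; last by rewrite oner_eq0.
by rewrite xzE; lmod.
Qed.

(** If h satisfies h ^ 2 = n + t h and k lies outside the field of h, then
    comparing coefficients in (h + k) ^ 2 and in (k h) ^ 2 on the basis
    1, h, k, k h gives first that k has the same trace t, then n t = 0. *)
Lemma quadratic_commutative : commutative (@GRing.mul H) -> forall h : H, h ^+ 2 \in 1%VS.
Proof.
move=> mulC h; have [/vlineP[c ->]|h1] := boolP (h \in 1%VS).
  by rewrite exprZn expr1n memvZ ?memv_line.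
have /mem_pairP[n [t hhE]] := quadH h.
have [k _ hk] : exists2 k, k \in {:H}%VS & k \notin (<[1]> + <[h]>)%VS.
  by apply: ex_notin; rewrite dimH dim_pair ?oner_neq0.
have /mem_pairP[n' [t' kkE]] := quadH k.
have /mem_pairP[c [d]] := quadH (h + k).
rewrite mulrDl !mulrDr hhE kkE (mulC h k) => eq1.
have [|_ tE t'E two0] := @subfield_indep k h (n + n' - c) (t - d) (t' - d) 2%:R h1 hk.
  by move/eqP: eq1; rewrite -subr_eq0 => /eqP eq0; rewrite -[RHS]eq0; lmod.
have {t'E} t'E : t' = t by rewrite (subr0_eq t'E) (subr0_eq tE).
have /mem_pairP[c' [d']] := quadH (k * h).
have -> : k * h * (k * h) = (k * k) * (h * h).
  by rewrite -!mulrA (mulrA h) (mulC h k) -!mulrA.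
rewrite hhE kkE t'E mulrDl !mulrDr -!scalerAl -!scalerAr !mul1r !mulr1 !scalerA => eq2.
have [|_ _ nt _] := @subfield_indep k h (n' * n - c') (n' * t) (n * t) (t * t - d') h1 hk.
  by move/eqP: eq2; rewrite -subr_eq0 => /eqP eq0; rewrite -[RHS]eq0; lmod.
have nzh : h != 0 by apply: contraNneq h1 => ->; rewrite mem0v.
rewrite expr2 hhE; move/eqP: nt; rewrite mulf_eq0 => /orP[/eqP n0|/eqP->]; last first.
  by rewrite scale0r addr0 memvZ ?memv_line.
case/vlineP: h1; exists t; apply: (mulrI (divH nzh)).
by rewrite hhE n0 scale0r add0r -scalerAr mulr1.
Qed.

(** A central element z outside F makes the whole algebra commutative: a basis is
    1, z, x, x z for any x outside <[1, z]>, and x commutes with each of these. *)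
Lemma quadratic_division_algebra :
  quaternion_skew_field H \/ quartic_field_with_squares_in_base H.
Proof.
have [Z1|Z1] := eqVneq 'Z({:H})%VS 1%VS; [by left; split | right].
have [z Zz z1] : exists2 z, z \in 'Z({:H})%VS & z \notin 1%VS.
  apply/subvPn; apply: contra Z1 => sZ1; rewrite eqEsubv sZ1 -memvE.
  by rewrite memv_cap memvf centv1.
have zC y : z * y = y * z.
  by move: Zz; rewrite memv_cap => /andP[_ /centvP]; apply; rewrite memvf.
have mulC : commutative (@GRing.mul H).
  move=> x y; have [/mem_pairP[a [b ->]]|xz] := boolP (x \in (<[1]> + <[z]>)%VS).
    by rewrite mulrDl mulrDr -!scalerAl -!scalerAr mul1r mulr1 zC.
  have Cx : x \in ('C[x])%VS := cent1v_id x.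
  have Cz : z \in ('C[x])%VS by apply/cent1vP.
  apply/esym/cent1vP; apply: (subvP (_ : {:H} <= 'C[x])%VS); rewrite ?memvf //.
  by rewrite (subfield_basis z1 xz) !subv_add -!memvE cent1v1 Cz Cx /= memvM.
by split=> //; apply: quadratic_commutative.
Qed.

End Classification.

Section DivisionAlgebras.
Variables (F : fieldType) (H : falgType F).

Lemma no_zero_divisors_division :
  (forall x y : H, x != 0 -> y != 0 -> x * y != 0) -> division_algebra H.
Proof.
move=> nzM x nzx.
have [y yx] : exists y, y * x = 1.
  have kr : lker (amulr x) == 0%VS.
    rewrite -subv0; apply/subvP => y; rewrite memv_ker lfunE /= memv0.
    by apply: contraLR => nzy; apply: nzM.
  by exists ((amulr x)^-1%VF 1); have := lker0_lfunVK kr 1; rewrite lfunE.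
have [z xz] : exists z, x * z = 1.
  have kl : lker (amull x) == 0%VS.
    rewrite -subv0; apply/subvP => z; rewrite memv_ker lfunE /= memv0.
    by apply: contraLR => nzz; apply: nzM.
  by exists ((amull x)^-1%VF 1); have := lker0_lfunVK kl 1; rewrite lfunE.
apply/unitrP; exists y; split=> //.
by rewrite -[y]mulr1 -xz mulrA yx mul1r.
Qed.

(** In a quaternion skew field the algebra generated by x has dimension 1, 2 or 4;
    dimension 4 would make x central. *)
Lemma Clifford_algebra_quadratic :
  quaternion_skew_field H \/ quartic_field_with_squares_in_base H ->
  forall x : H, x * x \in (<[1]> + <[x]>)%VS.
Proof.
move=> HH x; have [/vlineP[c xE]|x1] := boolP (x \in 1%VS).
  by rewrite {1}xE -scalerAl mul1r memvZ ?mem_pairr.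
case: HH => [[dimH divH Z1]|[_ _ _ sq]]; last first.
  by rewrite -expr2; apply: (subvP (addvSl _ _)); apply: sq.
have dH : \dim {:H} = 4%N by exact: dimH.
pose A := agenv (<[1]> + <[x]>)%VS.
have sKA : (<[1]> + <[x]> <= A)%VS := sub_agenv _.
have Ax : x \in A by apply: (subvP sKA); exact: mem_pairr.
have dK : \dim (<[1]> + <[x]>)%VS = 2%N by rewrite dim_pair ?oner_neq0.
have dvdA : (\dim A %| 4)%N by rewrite -dH; apply: (skew_field_dimS divH); apply: subvf.
have [dA|dA] := leqP (\dim A) 2.
  have -> : (<[1]> + <[x]>)%VS = A by apply: dim_eq_sub; rewrite ?dK.
  by apply: memvM.
have fullA : {:H}%VS = A.
  apply/eqP; rewrite eq_sym eqEdim subvf dH.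
  by move: dvdA dA; case: (\dim A) => [|[|[|[|[|n]]]]].
case/negP: x1; rewrite -Z1 memv_cap memvf /= -subv_cent1 fullA.
apply: agenv_sub_modl; first exact: cent1v1.
apply/prodvP => _ y /mem_pairP[a [b ->]] Cy.
by rewrite memvM // rpredD ?memvZ ?cent1v1 ?cent1v_id.
Qed.

End DivisionAlgebras.

Section PointsAndLines.
Variables (F : fieldType) (V : vectType F).
Implicit Types (M N : line V).

Lemma line_dim M : \dim M = 2%N.
Proof. exact: (eqP (valP M)). Qed.

Lemma lineP (L : {vspace V}) : \dim L = 2%N -> exists M : line V, M = L :> {vspace V}.
Proof. by move=> dL; have lL : is_line L by [apply/eqP]; exists (Sub L lL). Qed.

Lemma point_pick (p : {vspace V}) : is_point p -> exists2 v, v != 0 & p = <[v]>%VS.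
Proof.
move=> /eqP dp; have nzv : vpick p != 0 by rewrite vpick0 -dimv_eq0 dp.
exists (vpick p) => //; apply/esym/eqP; rewrite eqEdim dim_vline nzv dp.
by rewrite -memvE memv_pick.
Qed.

Lemma line_is_point (v : V) : v != 0 -> is_point <[v]>%VS.
Proof. by move=> nzv; rewrite /is_point dim_vline nzv. Qed.

End PointsAndLines.

(** * Clifford parallelisms have crossed pencils *)

Section FromActions.
Variables (F : fieldType) (V : vectType F) (par : line V -> line V -> Prop).
Hypothesis parP : parallelism par.
Variables (I : Type) (T : I -> 'End(V)).
Hypothesis T_inj : forall c, lker (T c) == 0%VS.
Hypothesis T_par : forall M N : line V, par M N <-> exists c, (T c @: M)%VS = N.
Hypothesis T_trans : forall v w, v != 0 -> w != 0 -> exists c, T c v = w.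
Hypothesis T_quad : forall c v, T c (T c v) \in (<[v]> + <[T c v]>)%VS.

(** By uniqueness of parallels, the N_i are the images of the M_i under any map T c
    taking v to w, where v and w span the points p and q. Since T c is
    quadratic and injective, v = T c u for some u in the span of v and w. *)
Lemma crossed_pencils_of_action : crossed_pencils par.
Proof.
case: parP => _ par_uniq M1 N1 M2 N2 par1 par2 p q pt_p pt_q neqpq.
have [v nzv pE] := point_pick pt_p; have [w nzw qE] := point_pick pt_q.
have [c Tv] := T_trans nzv nzw.
have [M1v M2v] : v \in vspace_of_line M1 /\ v \in vspace_of_line M2.
  by apply/memv_capP; rewrite -/p pE memv_line.
have [N1w N2w] : w \in vspace_of_line N1 /\ w \in vspace_of_line N2.
  by apply/memv_capP; rewrite -/q qE memv_line.
have imgE (M N : line V) : par M N -> v \in vspace_of_line M ->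
    w \in vspace_of_line N -> N = (T c @: M)%VS :> {vspace V}.
  move=> parMN Mv Nw; have [N' N'E] : exists N' : line V, N' = (T c @: M)%VS :> {vspace V}.
    by apply: lineP; rewrite limg_dim_eq ?line_dim // (eqP (T_inj c)) capv0.
  have [N0 [_ N0P]] := par_uniq _ M (line_is_point nzw).
  have N0N : N0 = N by apply: N0P.
  have N0N' : N0 = N'.
    apply: N0P; rewrite N'E -memvE -Tv memv_img //; split=> //.
    by apply/T_par; exists c.
  by rewrite -N'E -N0N' N0N.
have N1E := imgE M1 N1 par1 M1v N1w; have N2E := imgE M2 N2 par2 M2v N2w.
case=> p' [Z [[_ /eqP dZ _] [/and3P[_ _ M1Z] /and3P[_ _ M2Z] /and3P[lpq _ pqZ]]]].
have dsum (L L' : line V) : is_point (L :&: L')%VS -> \dim (L + L')%VS = 3%N.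
  move=> /eqP dLL; apply/eqP; rewrite -(eqn_add2r 1) -{1}dLL dimv_sum_cap.
  by rewrite !line_dim.
have ZE : (M1 + M2)%VS = Z.
  by apply: dim_eq_sub; rewrite ?subv_add ?M1Z // (dsum _ _ pt_p) dZ.
have Zw : w \in (M1 + M2)%VS by rewrite ZE memvE -qE (subv_trans _ pqZ) ?addvSr.
have Zv : v \in (M1 + M2)%VS by apply: (subvP (addvSl _ _)).
have Nv : v \in (N1 + N2)%VS.
  rewrite N1E N2E -limgD; have /mem_pairP[a [b TTv]] := T_quad c v.
  rewrite Tv in TTv; have [a0|nza] := eqVneq a 0.
    have wE : w = b *: v.
      by apply: (lker0P (T_inj c)); rewrite linearZ /= Tv TTv a0 scale0r add0r.
    have nzb : b != 0 by apply: contraNneq nzw => b0; rewrite wE b0 scale0r.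
    case/negP: neqpq; rewrite pE qE eqEdim !dim_vline nzv nzw -memvE andbT.
    by rewrite -(memv_scale _ _ nzb) -wE memv_line.
  suff -> : v = T c (a^-1 *: (w - b *: v)) by rewrite memv_img ?memvZ ?rpredB ?memvZ.
  by rewrite linearZ linearB linearZ /= Tv TTv; lmod.
exists q, (N1 + N2)%VS; split; split=> //.
- by apply/eqP; rewrite (dsum _ _ pt_q).
- by rewrite qE -memvE (subvP (addvSl _ _)).
- by rewrite inE (valP N1) capvSl addvSl.
- by rewrite inE (valP N2) capvSr addvSr.
- by rewrite inE lpq addvSr subv_add pE qE -!memvE Nv (subvP (addvSl _ _)).
Qed.

End FromActions.

(** Left and right parallelism are treated alike, mu being left or right
    multiplication. *)
Lemma Clifford_crossed (F : fieldType) (V : vectType F) (par : line V -> line V -> Prop) :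
  parallelism par -> Clifford par -> crossed_pencils par.
Proof.
move=> parP [H [phi [[psi phiK psiK] HH par_phi]]].
have quadH := Clifford_algebra_quadratic HH.
have divH : division_algebra H by case: HH => -[].
have kphi : lker phi == 0%VS by apply/lker0P; exact: can_inj phiK.
have phiVK : cancel phi^-1%VF phi.
  by move=> h; rewrite -[h]psiK (lker0_lfunK kphi).
have VphiK := lker0_lfunK kphi.
pose T (mu : H -> 'End(H)) (c : {c : H | c != 0}) : 'End(V) := (phi^-1 \o mu (val c) \o phi)%VF.
have TE mu c v : T mu c v = phi^-1%VF (mu (val c) (phi v)) by rewrite !comp_lfunE.
have T_imgE mu c (M N : line V) : ((T mu c @: M)%VS = N) <-> (mu (val c) @: (phi @: M))%VS = (phi @: N)%VS.
  rewrite !limg_comp; split=> [<-|->].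
    by apply/vspaceP => h; apply/idP/memv_imgP => [Mh|[u /memv_imgP[w Mw ->] ->]];
      [exists (phi^-1%VF h); rewrite ?memv_img ?phiVK | rewrite phiVK].
  by apply/vspaceP => h; apply/memv_imgP/idP => [[u /memv_imgP[w Mw ->] ->]|Nh];
      [rewrite VphiK | exists (phi h); rewrite ?memv_img ?VphiK].
suff [mu [mu_inj mu_trans mu_quad mu_par]] : exists mu : H -> 'End(H),
   [/\ forall c, c != 0 -> injective (mu c),
       forall v w, v != 0 -> w != 0 -> exists2 c, c != 0 & mu c v = w,
       forall c v, mu c (mu c v) \in (<[v]> + <[mu c v]>)%VS
     & forall M N : line V, par M N <-> exists2 c, c != 0 & (mu c @: (phi @: M))%VS = (phi @: N)%VS].
  apply: (@crossed_pencils_of_action _ _ _ parP _ (T mu)).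
  - case=> c nzc; apply/lker0P => u v; rewrite !TE /= => eqT.
    by apply/(can_inj phiK)/(mu_inj c nzc)/(can_inj phiVK).
  - move=> M N; rewrite mu_par; split=> [[c nzc /(T_imgE mu (Sub c nzc))]|[c /T_imgE]].
      by exists (Sub c nzc).
    by exists (val c); rewrite ?(valP c).
  - move=> v w nzv nzw; have phi_nz x : x != 0 -> phi x != 0.
      by rewrite -(inj_eq (can_inj phiK)) linear0.
    have [c nzc cv] := mu_trans _ _ (phi_nz v nzv) (phi_nz w nzw).
    by exists (Sub c nzc); rewrite TE /= cv VphiK.
  - move=> c v; rewrite !TE phiVK; have /mem_pairP[a [b ->]] := mu_quad (val c) (phi v).
    by apply/mem_pairP; exists a, b; rewrite linearD !linearZ /= VphiK.
case: par_phi => par_phi; [exists (@amull F H) | exists (@amulr F H)]; split.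
- by move=> c nzc; apply/lker0P/lker0_amull/divH.
- move=> v w nzv nzw; have Uv := divH v nzv; exists (w / v); last by rewrite lfunE /= mulrVK.
  by apply: contraNneq nzw => wv0; rewrite -(mulrVK Uv w) wv0 mul0r.
- move=> c v; rewrite !lfunE /= mulrA; have /mem_pairP[a [b ->]] := quadH c.
  by apply/mem_pairP; exists a, b; rewrite mulrDl -!scalerAl mul1r.
- exact: par_phi.
- by move=> c nzc; apply/lker0P/lker0_amulr/divH.
- move=> v w nzv nzw; have Uv := divH v nzv; exists (v^-1 * w); last by rewrite lfunE /= mulVKr.
  by apply: contraNneq nzw => wv0; rewrite -(mulVKr Uv w) wv0 mulr0.
- move=> c v; rewrite !lfunE /= -mulrA; have /mem_pairP[a [b ->]] := quadH c.
  by apply/mem_pairP; exists a, b; rewrite mulrDr -!scalerAr mulr1.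
- exact: par_phi.
Qed.

(** * Parallelisms with crossed pencils are Clifford *)

Section ParallelFunction.
Variables (F : fieldType) (V : vectType F) (par : line V -> line V -> Prop).
Hypothesis parP : parallelism par.

Lemma parallel_fun_ex : exists2 P : {vspace V} -> V -> {vspace V}, parallel_fun P &
  forall (M N : line V) v, v != 0 -> v \in vspace_of_line N ->
    par M N <-> P M v = N :> {vspace V}.
Proof.
have [[par_refl par_sym par_trans] par_uniq] := parP.
have /functional_choice[Q QP] : forall Mv : line V * V, exists N : line V,
    Mv.2 != 0 -> par Mv.1 N /\ Mv.2 \in vspace_of_line N.
  case=> M v /=; have [->|nzv] := eqVneq v 0; first by exists M.
  have [N [parN _]] := par_uniq _ M (line_is_point nzv).
  by exists N.
have uniqQ M N v : v != 0 -> par M N -> v \in vspace_of_line N -> Q (M, v) = N.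
  move=> nzv parMN Nv; have [N0 [_ N0P]] := par_uniq _ M (line_is_point nzv).
  have N0N : N0 = N by apply: N0P.
  have N0Q : N0 = Q (M, v) by apply: N0P; exact: (QP (M, v) nzv).
  by rewrite -N0Q.
pose P (L : {vspace V}) v : {vspace V} :=
  if insub L is Some M then vspace_of_line (Q (M, v)) else L.
have PE (M : line V) v : P M v = Q (M, v) by rewrite /P valK.
have QP1 M v : v != 0 -> par M (Q (M, v)) by move=> nzv; case: (QP (M, v) nzv).
have QP2 M v : v != 0 -> v \in vspace_of_line (Q (M, v)).
  by move=> nzv; case: (QP (M, v) nzv).
exists P => [|M N v nzv Nv].
  split=> [L v|L v|L v|L w v] /lineP[M <-].
  - by rewrite PE line_dim.
  - by rewrite PE; apply: QP2.
  - by move=> nzv Mv; rewrite PE (uniqQ M M).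
  - move=> nzw nzv; rewrite !PE; congr vspace_of_line; apply: uniqQ => //; last exact: QP2.
    by apply: (par_trans _ M); [apply: par_sym|]; apply: QP1.
split=> [parMN|]; first by rewrite PE (uniqQ M N).
by rewrite PE => /val_inj <-; apply: QP1.
Qed.

Hypothesis crossedP : crossed_pencils par.

Lemma parallel_fun_crossed (P : {vspace V} -> V -> {vspace V}) : parallel_fun P ->
  (forall (M N : line V) v, v != 0 -> v \in vspace_of_line N ->
    par M N <-> P M v = N :> {vspace V}) ->
  crossed_fun P.
Proof.
move=> funP parE L M p q dL dM nzp nzq Eq.
have [/vlineP[c qE]|pq] := boolP (q \in <[p]>%VS).
  have nzc : c != 0 by apply: contraNneq nzq => c0; rewrite qE c0 scale0r.
  by rewrite -(memv_scale _ _ nzc) -qE (subvP (addvSl _ _)) ?(par_mem funP).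
have [eqp|neqp] := eqVneq (P L p) (P M p).
  rewrite -eqp addvv in Eq; rewrite (subvP (addvSl _ _)) //.
  by rewrite (spread_eq (par_spread funP dL) nzp nzq Eq) (par_mem funP).
have neqq : P L q != P M q.
  by apply: contraNneq neqp => /(par_eq_at funP dL dM nzq nzp) ->.
have [L0 L0E] := lineP dL; have [M0 M0E] := lineP dM.
have [M1 M1E] := lineP (par_dim funP dL nzp); have [M2 M2E] := lineP (par_dim funP dM nzp).
have [N1 N1E] := lineP (par_dim funP dL nzq); have [N2 N2E] := lineP (par_dim funP dM nzq).
have par1 : par M1 N1.
  by apply/(parE _ _ q nzq); rewrite ?M1E ?N1E ?(par_mem funP) ?(par_par funP).
have par2 : par M2 N2.
  by apply/(parE _ _ q nzq); rewrite ?M2E ?N2E ?(par_mem funP) ?(par_par funP).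
have cap v (A B : {vspace V}) : v != 0 -> \dim A = 2%N -> \dim B = 2%N -> v \in A -> v \in B ->
    A != B -> (A :&: B)%VS = <[v]>%VS.
  move=> nzv dA dB Av Bv neqAB; apply/eqP; rewrite eq_sym eqEdim -memvE memv_cap Av Bv.
  rewrite dim_vline nzv /= -(leq_add2l (\dim (A + B))) dimv_sum_cap.
  by rewrite (dim_lines dA dB nzv) // dA dB.
have := crossedP par1 par2; rewrite /= M1E M2E N1E N2E.
rewrite (cap p (P L p)) ?(cap q (P L q)) ?(par_dim funP) ?(par_mem funP) //.
have sM (A B : {vspace V}) v : v \in A -> (<[v]> <= A + B)%VS.
  by move=> Av; rewrite -memvE (subvP (addvSl _ _)).
case.
- exact: line_is_point.
- exact: line_is_point.
- by apply: contraNneq pq => eqpq; rewrite eqpq memv_line.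
- exists <[p]>%VS, (P L p + P M p)%VS; split; split.
  + exact: line_is_point.
  + by apply/eqP; rewrite (dim_lines _ _ nzp) ?(par_dim funP) ?(par_mem funP).
  + by apply: sM; rewrite (par_mem funP).
  + by rewrite inE -!memvE /is_line (par_dim funP) ?(par_mem funP) ?addvSl.
  + by rewrite inE -!memvE /is_line (par_dim funP) ?(par_mem funP) ?addvSr.
  + rewrite inE addvSl subv_add sM ?(par_mem funP) -?memvE ?Eq ?andbT //.
    by apply/eqP; rewrite dim_pair.
move=> p' [Z [[_ /eqP dZ _] [/and3P[_ _ LZ] /and3P[_ _ MZ] /and3P[_ _ pqZ]]]].
have -> : (P L q + P M q)%VS = Z.
  apply: dim_eq_sub; first by rewrite subv_add LZ.
  by rewrite dZ (dim_lines _ _ nzq) ?(par_dim funP) ?(par_mem funP).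
by apply: (subvP pqZ); exact: mem_pairl.
Qed.

(** The algebra has V as underlying space and any nonzero vector e as its unit, so
    the identity serves as the isomorphism. *)
Lemma crossed_Clifford : \dim {:V} = 4%N -> Clifford par.
Proof.
move=> dimV; have [P funP parE] := parallel_fun_ex.
have crossed := parallel_fun_crossed funP parE.
have [J JP] := J_ex dimV funP crossed.
have [e _ nze] : exists2 e, e \in {:V}%VS & e \notin 0%VS.
  by apply: ex_notin; rewrite dimv0 dimV.
rewrite memv0 in nze.
have JC u y : u != 0 -> classwise P (J u y) by move=> nzu; case: (JP u y nzu).
have JE u y : u != 0 -> J u y u = y by move=> nzu; case: (JP u y nzu).
pose mul x y := J e y x.
have mulA : associative mul.
  by move=> x y z; rewrite /mul (J_assoc dimV funP crossed JC JE).
have mul1l : left_id e mul by move=> x; apply: JE.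
have mul1r : right_id e mul.
  move=> x; have Jee : J e e = 1 *: \1%VF.
    by apply: (classwise_scalar dimV funP (JC e e nze) nze); rewrite JE ?scale1r.
  by rewrite /mul Jee !lfun_simp scale1r.
have mulDl : left_distributive mul +%R by move=> x y z; rewrite /mul linearD.
have mulDr : right_distributive mul +%R.
  by move=> x y z; rewrite /mul (JD dimV funP crossed JC JE) ?add_lfunE.
have mulZl a x y : a *: mul x y = mul (a *: x) y by rewrite /mul linearZ.
have mulZr a x y : a *: mul x y = mul x (a *: y).
  by rewrite /mul (JZ dimV funP JC JE) ?scale_lfunE.
pose m := AlgebraLaw mulA mul1l mul1r mulDl mulDr mulZl mulZr nze.
pose H : falgType F := algebra_of m.
have mulE (x y : H) : x * y = J e y x :> V by [].
have divH : division_algebra H.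
  apply: no_zero_divisors_division => x y nzx nzy.
  exact: (J_neq0 dimV funP JC JE nze nzy nzx).
have quadH (x : H) : x * x \in (<[1]> + <[x]>)%VS.
  exact: (J_quadratic funP JC JE x nze).
have dimH : \dim {:H} = 4%N by exact: dimV.
pose phi : 'Hom(V, H) := (\1%VF : 'End(V)).
have phiE v : phi v = v by exact: id_lfunE.
have kphi : lker phi == 0%VS by apply/lker0P => x y; rewrite !phiE.
have imgE (c v : V) (M : line V) : c != 0 -> v != 0 -> v \in vspace_of_line M ->
    (amull (c : H) @: (phi @: M))%VS = (phi @: P M (mul c v))%VS.
  move=> nzc nzv Mv; have nzcv : mul c v != 0 := J_neq0 dimV funP JC JE nze nzv nzc.
  have kc : lker (amull (c : H)) == 0%VS by apply/lker0_amull/divH.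
  apply: dim_eq_sub.
    apply/subvP => _ /memv_imgP[_ /memv_imgP[u Mu ->] ->].
    have -> : amull (c : H) (phi u) = phi (mul c u) by rewrite lfunE !phiE.
    apply: memv_img.
    exact: (J_parallel dimV funP crossed JC JE (line_dim M) nze nzv nzc Mu Mv).
  by rewrite !limg_dim_eq ?(eqP kphi) ?(eqP kc) ?capv0 // line_dim (par_dim funP) ?line_dim.
exists H, phi; split.
- by exists id => v; apply: phiE.
- exact: quadratic_division_algebra.
left=> M N; have pick_line (L : line V) : exists2 v, v != 0 & v \in vspace_of_line L.
  exists (vpick L); rewrite ?memv_pick // vpick0 -dimv_eq0.
  by rewrite (line_dim L).
have [v nzv Mv] := pick_line M; split=> [parMN|[c nzc]].
  have [w nzw Nw] := pick_line N; pose c : H := (w : H) / (v : H).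
  have cv : mul c v = w := mulrVK (divH v nzv) (w : H).
  have nzc : c != 0.
    by apply: contraNneq nzw => c0; rewrite -cv c0 /mul linear0.
  by exists c => //; rewrite (imgE c v) // cv; congr (_ @: _)%VS; apply/parE.
rewrite (imgE c v) // => /eqP; rewrite eq_limg_ker0 // => /eqP PN.
have nzcv : mul c v != 0 := J_neq0 dimV funP JC JE nze nzv nzc.
by apply/(parE _ _ _ nzcv) => //; rewrite -PN (par_mem funP) ?line_dim.
Qed.

End ParallelFunction.

Local Close Scope ring_scope.

Theorem theorem6p3 (F : fieldType) (V : vectType F) (dimV : \dim {:V} = 4)
    (par : line V -> line V -> Prop) (par_parallelism : parallelism par) :
  Clifford par <-> crossed_pencils par.
Proof.
split; first exact: Clifford_crossed.
by move=> crossed; apply: crossed_Clifford.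
Qed.
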